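(* Let $\theta,\varphi\in\mathbb R$, $R>\hat R:=8\,e^{(2e)^{-1}}$ and $T>0$. Then there exists a number $\hat C>0$ such that for all functions $y^0,\widetilde y^0\in\mathcal R_{R,\hat C}$ which are odd with respect to $0$, there exist $y\in G^{1,2}([0,1]\times[0,T])$ and $v\in G^2([0,T])$ satisfying $$\partial_ty=e^{i\theta}\partial_x^2y+e^{i\varphi}|y|^2y,\quad x\in[0,1],\ t\in[0,T],$$ $$y(0,t)=0,\quad y(1,t)=v(t),\quad t\in[0,T],$$ $$y(x,0)=y^0(x),\quad x\in[0,1],$$ together with $y(x,T)=\widetilde y^0(x)$ for all $x\in[0,1]$.
   Context: All functions are complex-valued. $\mathcal R_{R,C}$ ($R>1$, $C>0$): functions $z:[-1,1]\to\mathbb C$ for which there is a complex sequence $(\alpha_n)_{n\ge0}$ with $|\alpha_n|\le C\,n!/R^n$ for all $n$ and $z(x)=\sum_{n\ge0}\alpha_nx^n/n!$ for all $x\in[-1,1]$. Gevrey classes: $h\in G^s([t_1,t_2])$ if $h\in C^\infty$ and $|h^{(p)}(t)|\le C(p!)^s/R^p$ for some $C,R>0$ and all $p\in\mathbb N$, $t\in[t_1,t_2]$. $y\in G^{s_1,s_2}([x_1,x_2]\times[t_1,t_2])$ if $y\in C^\infty$ and $|\partial_x^{p_1}\partial_t^{p_2}y(x,t)|\le C(p_1!)^{s_1}(p_2!)^{s_2}/(R_1^{p_1}R_2^{p_2})$ for some $C,R_1,R_2>0$, all $(x,t)$ and all $p_1,p_2\in\mathbb N$. *)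

(* Defs.v *)
(* Stdlib reals and Coquelicot: complex-valued functions of real variables are
   total functions R -> C (or R -> R -> C), and only their values on the stated
   intervals matter. *)
From Stdlib Require Import Reals Factorial.
From Coquelicot Require Import Coquelicot.
Open Scope R_scope.

Definition cis (theta : R) : C := (cos theta, sin theta).

Definition in_segment (a b : R) (x : R) : Prop := a <= x <= b.

(* Derivative relative to [a, b], hence one-sided at a and at b. Here and below
   C carries its structure of normed space over R (C_R_NormedModule), not the
   default one over itself. *)
Definition is_derive_on (a b : R) (f : R -> C) (x : R) (l : C) : Prop :=
  filterdiff (K := R_AbsRing) (U := R_NormedModule) (V := C_R_NormedModule)
    f (within (in_segment a b) (locally x))
    (fun u : R => scal (V := C_R_NormedModule) u l).

Definition ex_derive_on (a b : R) (f : R -> C) (x : R) : Prop :=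
  exists l : C, is_derive_on a b f x l.

(* Meaningful when a < b, a <= x <= b and f is derivable at x relative to [a, b]:
   the derivative is then unique. *)
Definition Derive_on (a b : R) (f : R -> C) (x : R) : C :=
  iota (T := C_R_CompleteNormedModule) (is_derive_on a b f x).

Definition Derive_n_on (a b : R) (n : nat) (f : R -> C) : R -> C :=
  Nat.iter n (Derive_on a b) f.

Definition smooth_on (a b : R) (f : R -> C) : Prop :=
  forall (n : nat) (x : R), in_segment a b x ->
    ex_derive_on a b (Derive_n_on a b n f) x.

Definition rectangle (x1 x2 t1 t2 : R) (p : R * R) : Prop :=
  in_segment x1 x2 (fst p) /\ in_segment t1 t2 (snd p).

Definition partial_x (x1 x2 : R) (y : R -> R -> C) : R -> R -> C :=
  fun x t => Derive_on x1 x2 (fun x' => y x' t) x.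

Definition partial_t (t1 t2 : R) (y : R -> R -> C) : R -> R -> C :=
  fun x t => Derive_on t1 t2 (fun t' => y x t') t.

Fixpoint Cn_on (x1 x2 t1 t2 : R) (n : nat) (y : R -> R -> C) : Prop :=
  continuous_on (T := prod_UniformSpace R_UniformSpace R_UniformSpace)
    (U := C_UniformSpace) (rectangle x1 x2 t1 t2)
    (fun p => y (fst p) (snd p)) /\
  match n with
  | O => True
  | S m =>
      (forall x t, in_segment x1 x2 x -> in_segment t1 t2 t ->
         ex_derive_on x1 x2 (fun x' => y x' t) x /\
         ex_derive_on t1 t2 (fun t' => y x t') t) /\
      Cn_on x1 x2 t1 t2 m (partial_x x1 x2 y) /\
      Cn_on x1 x2 t1 t2 m (partial_t t1 t2 y)
  end.

Definition smooth_on_rectangle (x1 x2 t1 t2 : R) (y : R -> R -> C) : Prop :=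
  forall n : nat, Cn_on x1 x2 t1 t2 n y.

(* (p!)^s for a real exponent s. *)
Definition fact_pow (p : nat) (s : R) : R := Rpower (INR (fact p)) s.

Definition gevrey (s t1 t2 : R) (h : R -> C) : Prop :=
  smooth_on t1 t2 h /\
  exists K r : R, 0 < K /\ 0 < r /\
    forall (p : nat) (t : R), in_segment t1 t2 t ->
      Cmod (Derive_n_on t1 t2 p h t) <= K * fact_pow p s / r ^ p.

Definition gevrey2 (s1 s2 x1 x2 t1 t2 : R) (y : R -> R -> C) : Prop :=
  smooth_on_rectangle x1 x2 t1 t2 y /\
  exists K r1 r2 : R, 0 < K /\ 0 < r1 /\ 0 < r2 /\
    forall (p1 p2 : nat) (x t : R),
      in_segment x1 x2 x -> in_segment t1 t2 t ->
      Cmod (Nat.iter p1 (partial_x x1 x2) (Nat.iter p2 (partial_t t1 t2) y) x t)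
        <= K * (fact_pow p1 s1 * fact_pow p2 s2) / (r1 ^ p1 * r2 ^ p2).

(* The class written R_{r,K} in the literature, for r > 1 and K > 0. *)
Definition analytic_class (r K : R) (z : R -> C) : Prop :=
  exists alpha : nat -> C,
    (forall n : nat, Cmod (alpha n) <= K * INR (fact n) / r ^ n) /\
    (forall x : R, in_segment (-1) 1 x ->
       is_pseries (K := R_AbsRing) (V := C_R_NormedModule)
         (fun n => (alpha n / RtoC (INR (fact n)))%C) x (z x)).

Definition odd_function (z : R -> C) : Prop :=
  forall x : R, in_segment (-1) 1 x -> z (- x) = (- z x)%C.

Definition R_hat : R := 8 * exp (/ (2 * exp 1)).

(* Main.v *)
Require Import Defs.
From Stdlib Require Import Reals Factorial Arith Lra Lia.
From Coquelicot Require Import Coquelicot.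
Open Scope R_scope.

(** The equation can be read in two directions. Solved for the time derivative, it
    determines from an analytic state [sum alpha_k x ^ k / k!] all the derivatives
    of a solution at that instant, in particular the time jet of [dy/dx] at [x = 0].
    Solved for the second space derivative, it determines a solution from its traces
    at [x = 0], namely [y (0, t) = 0], forced by oddness, and [dy/dx (0, t) = g t].
    It suffices to find a function [g] of Gevrey order [2] having at [t = 0] and at
    [t = T] the jets dictated by the two prescribed states: the solution launched in
    space by [g] then has the right Taylor coefficients in [x] at both instants, and
    its trace at [x = 1] is the control [v].

    Both marches are carried out on the coefficients [u k n] of [x ^ k] and of the
    time increment to the power [n], related by the recursion [solves]. They are
    bounded by [M * a ^ k * b ^ n * gw k n], where [gw k n = (k + 2 n)! / (k! n!)]
    reflects that one time derivative is worth two space derivatives. The linear part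
    of the recursion respects such a bound, with a factor [a ^ 2 / b] in the march in
    time ([solves_time_bound]) and [b / a ^ 2] in the march in space
    ([solves_space_bound]). The cubic term is a triple convolution, under which the
    weight is stable up to a factor quadratic in [k] ([cubic_bound]); the two orders of
    differentiation that separate it from the linear terms compensate this factor, and
    for small [M] it fits into any margin left by the linear part. So the nonlinearity costs almost nothing in the rates: a trace
    [g] of rate [b < 1] launches a solution whose series in [x] converges beyond [1].

    The factor that is really lost lies in the construction of [g] from its jets
    ([gevrey_interpolation]). The divergent series [sum delta_q t ^ q] is replaced by
    [sum delta_q * kap s q t], where [kap s q] is a truncated Laplace integral with
    the Taylor series of [t ^ q] and the size [s ^ q / q!]. Its derivatives are again
    of this type up to flat functions [t ^ (- j) * exp (- s / t)], which are explicit
    enough to be bounded by hand ([kapjet_bound], [borel]). The rate of the jets is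
    multiplied by a number arbitrarily close to [32]. It is close to [1 / 64] for
    states of radius of convergence above [8], and [8 <= R_hat]; hence [g] has a rate
    below [1]. The same flat functions provide a transition function between the two
    instants, whose rate does not depend on how close they are
    ([transition_function]).

    All differentiations, including those under the summation signs, are handled by
    a remainder estimate uniform on the closed interval ([qdiff]). *)

(** * Factorials and binomial weights *)

Notation fct n := (INR (fact n)).

Lemma fct_pos n : 0 < fct n.
Proof. apply INR_fact_lt_0. Qed.

Lemma fct_S n : fct (S n) = (INR n + 1) * fct n.
Proof. rewrite fact_simpl, mult_INR, S_INR. reflexivity. Qed.

(** The binomial coefficient of [p + q] over [p], indexed by its two parts so as
    to avoid truncated subtraction. *)
Definition bin (p q : nat) : R := fct (p + q) / (fct p * fct q).

Lemma bin_0l q : bin 0 q = 1.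
Proof. unfold bin. simpl. field. apply INR_fact_neq_0. Qed.

Lemma bin_0r p : bin p 0 = 1.
Proof. unfold bin. rewrite Nat.add_0_r. simpl. field. apply INR_fact_neq_0. Qed.

Lemma bin_SS p q : bin (S p) (S q) = bin p (S q) + bin (S p) q.
Proof.
  unfold bin.
  replace (S p + S q)%nat with (S (S (p + q))) by lia.
  replace (p + S q)%nat with (S (p + q)) by lia.
  replace (S p + q)%nat with (S (p + q)) by lia.
  rewrite !fct_S, !S_INR, plus_INR.
  pose proof (fct_pos p). pose proof (fct_pos q). pose proof (fct_pos (p + q)).
  pose proof (pos_INR p). pose proof (pos_INR q).
  field. repeat split; lra.
Qed.

Lemma bin_pos p q : 0 < bin p q.
Proof.
  unfold bin. apply Rdiv_lt_0_compat; [|apply Rmult_lt_0_compat]; apply fct_pos.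
Qed.

Lemma bin_S_r p q : bin p q <= bin p (S q).
Proof.
  destruct p as [|p]; [rewrite !bin_0l; lra|].
  rewrite bin_SS. pose proof (bin_pos p (S q)). lra.
Qed.

Lemma bin_S_l p q : bin p q <= bin (S p) q.
Proof.
  destruct q as [|q]; [rewrite !bin_0r; lra|].
  rewrite bin_SS. pose proof (bin_pos (S p) q). lra.
Qed.

(** Choosing [i] elements from one pool and [p] from another is one way of choosing
    [i + p] from their union; the proof is Pascal's rule. *)
Lemma bin_mul i j p q : bin i j * bin p q <= bin (i + p) (j + q).
Proof.
  revert q. induction p as [|p IHp]; intros q.
  - rewrite bin_0l, Rmult_1_r, Nat.add_0_r. induction q as [|q IH].
    + rewrite Nat.add_0_r. lra.
    + rewrite Nat.add_succ_r. eapply Rle_trans; [exact IH|apply bin_S_r].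
  - induction q as [|q IHq].
    + rewrite bin_0r, Rmult_1_r, Nat.add_0_r.
      rewrite Nat.add_succ_r. eapply Rle_trans; [|apply bin_S_l].
      specialize (IHp 0%nat). rewrite bin_0r, Rmult_1_r, Nat.add_0_r in IHp. exact IHp.
    + rewrite bin_SS, Rmult_plus_distr_l.
      replace (i + S p)%nat with (S (i + p)) in * by lia.
      replace (j + S q)%nat with (S (j + q)) by lia.
      rewrite bin_SS.
      specialize (IHp (S q)). replace (j + S q)%nat with (S (j + q)) in IHp by lia.
      lra.
Qed.

(** The left-hand side is one term of the binomial expansion of
    [(x + y) ^ (p + q)]. Taking [x] close to [1] makes a binomial coefficient cost
    hardly anything in its first index. *)
Lemma bin_weight x y p q : 0 <= x -> 0 <= y -> x + y = 1 ->
  bin p q * x ^ p * y ^ q <= 1.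
Proof.
  intros hx hy h. revert q. induction p as [|p IHp]; intros q.
  - rewrite bin_0l. simpl. assert (0 <= y ^ q <= 1).
    { split; [apply pow_le; lra|]. rewrite <- (pow1 q). apply pow_incr. lra. }
    lra.
  - induction q as [|q IHq].
    + rewrite bin_0r. assert (0 <= x ^ S p <= 1).
      { split; [apply pow_le; lra|]. rewrite <- (pow1 (S p)). apply pow_incr. lra. }
      simpl in *. lra.
    + rewrite bin_SS. specialize (IHp (S q)). simpl in *.
      set (A := bin p (S q)) in *. set (B := bin (S p) q) in *.
      set (X := x ^ p) in *. set (Y := y ^ q) in *.
      replace ((A + B) * (x * X) * (y * Y)) with
        (x * (A * X * (y * Y)) + y * (B * (x * X) * Y)) by ring.
      nra.
Qed.

Lemma bin_le_pow2 p q : bin p q <= 2 ^ (p + q).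
Proof.
  pose proof (bin_weight (/2) (/2) p q ltac:(lra) ltac:(lra) ltac:(lra)) as h.
  rewrite Rmult_assoc, <- pow_add, pow_inv in h.
  assert (0 < 2 ^ (p + q)) by (apply pow_lt; lra).
  apply (Rmult_le_compat_r (2 ^ (p + q))) in h; [|lra].
  rewrite Rmult_assoc, Rinv_l in h; lra.
Qed.

Lemma bin_S_S_ge p q : INR p + INR q + 2 <= bin (S p) (S q).
Proof.
  induction p as [|p IHp].
  - induction q as [|q IHq]; rewrite bin_SS, bin_0l.
    + rewrite bin_0r. simpl. lra.
    + rewrite S_INR. simpl (INR 0) in *. lra.
  - rewrite bin_SS, S_INR. enough (1 <= bin (S (S p)) q) by lra.
    clear. induction q as [|q IH]; [rewrite bin_0r; lra|].
    eapply Rle_trans; [exact IH|apply bin_S_r].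
Qed.

Lemma fct_split_le p q : fct (p + q) <= 2 ^ (p + q) * (fct p * fct q).
Proof.
  pose proof (bin_le_pow2 p q) as h. unfold bin in h.
  pose proof (fct_pos p). pose proof (fct_pos q).
  apply Rle_div_l in h; [exact h|]. nra.
Qed.

Lemma fct_mul_le p q : fct p * fct q <= fct (p + q).
Proof.
  assert (h : 1 <= bin p q).
  { pose proof (bin_mul 0 0 p q) as h. rewrite !Nat.add_0_l in h.
    induction p as [|p IH]; [rewrite bin_0l; lra|].
    eapply Rle_trans; [|apply bin_S_l]. apply IH. rewrite bin_0l. lra. }
  unfold bin in h. pose proof (fct_pos p). pose proof (fct_pos q).
  apply Rle_div_r in h; nra.
Qed.

(** Only the two outer coefficients of a row equal [1]; the others are at least [n],
    so that their inverses add up to a bounded quantity. *)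
Lemma sum_inv_bin n : sum_f_R0 (fun p => / bin p (n - p)) n <= 4.
Proof.
  set (u := fun p => if Nat.eq_dec p 0 then 1 else 0).
  set (v := fun p => if Nat.eq_dec p n then 1 else 0).
  assert (hu : forall m, sum_f_R0 u m = 1).
  { induction m; simpl; [|rewrite IHm]; unfold u; simpl; lra. }
  assert (hv : forall m, sum_f_R0 v m <= if le_dec n m then 1 else 0).
  { induction m as [|m IH]; simpl.
    - unfold v. destruct (Nat.eq_dec 0 n), (le_dec n 0); try lia; lra.
    - revert IH. unfold v at 3.
      destruct (Nat.eq_dec (S m) n), (le_dec n m), (le_dec n (S m)); try lia; lra. }
  specialize (hu n). specialize (hv n). destruct (le_dec n n) as [_|]; [|lia].
  eapply Rle_trans.
  { apply (sum_Rle _ (fun p => (u p + v p) + 2 / (INR n + 1)) n).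
    intros p hp. unfold u, v. pose proof (pos_INR n) as hn.
    assert (0 < 2 / (INR n + 1)) by (apply Rdiv_lt_0_compat; lra).
    destruct p as [|p].
    - rewrite bin_0l, Rinv_1. destruct (Nat.eq_dec 0 0), (Nat.eq_dec 0 n); lra || lia.
    - destruct (Nat.eq_dec (S p) 0) as [|_]; [lia|].
      destruct (Nat.eq_dec (S p) n) as [<-|ne].
      + rewrite Nat.sub_diag, bin_0r, Rinv_1. lra.
      + destruct n as [|n]; [lia|].
        replace (S n - S p)%nat with (S (n - S p)) by lia.
        pose proof (bin_S_S_ge p (n - S p)) as hb.
        rewrite <- plus_INR in hb. replace (p + (n - S p))%nat with (n - 1)%nat in hb by lia.
        rewrite minus_INR, INR_1 in hb by lia. rewrite S_INR in *.
        pose proof (pos_INR n).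
        apply Rle_trans with (/ (INR n + 1)).
        * apply Rinv_le_contravar; lra.
        * rewrite Rplus_0_l, Rplus_0_l. apply Rmult_le_reg_l with ((INR n + 1) * (INR n + 1 + 1)); [nra|].
          field_simplify; lra. }
  rewrite plus_sum, plus_sum, sum_cte, hu, S_INR.
  pose proof (pos_INR n) as hn.
  replace (2 / (INR n + 1) * (INR n + 1)) with 2 by (field; lra). lra.
Qed.

(** The Gevrey weight: with [a] and [b] geometric rates, the normalised derivative
    of order [k] in space and [n] in time of a solution is of size
    [a ^ k * b ^ n * gw k n], one time derivative costing two space derivatives. *)
Definition gw (k n : nat) : R := fct (k + 2 * n) / (fct k * fct n).

Lemma gw_pos k n : 0 < gw k n.
Proof.
  unfold gw. apply Rdiv_lt_0_compat; [|apply Rmult_lt_0_compat]; apply fct_pos.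
Qed.

Lemma gw_0r k : gw k 0 = 1.
Proof. unfold gw. rewrite Nat.mul_0_r, Nat.add_0_r. simpl. field. apply INR_fact_neq_0. Qed.

Lemma gw_mul i j p q : gw i p * gw j q * bin p q <= gw (i + j) (p + q).
Proof.
  pose proof (bin_mul (i + p) (j + q) p q) as h2.
  pose proof (bin_mul i j p q) as h1.
  pose proof (bin_pos p q) as hb. pose proof (bin_pos i j) as hij.
  assert (h : bin i j * bin p q * bin p q <= bin (i + 2 * p) (j + 2 * q)).
  { replace (i + 2 * p)%nat with (i + p + p)%nat by lia.
    replace (j + 2 * q)%nat with (j + q + q)%nat by lia.
    eapply Rle_trans; [|exact h2]. apply Rmult_le_compat_r; lra. }
  assert (hE : gw (i + j) (p + q) =
    bin (i + 2 * p) (j + 2 * q) * (gw i p * gw j q) / (bin i j * bin p q)).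
  { unfold gw, bin.
    replace (i + j + 2 * (p + q))%nat with (i + 2 * p + (j + 2 * q))%nat by lia.
    field. repeat split; apply INR_fact_neq_0. }
  rewrite hE. apply -> Rle_div_r; [|nra].
  pose proof (gw_pos i p). pose proof (gw_pos j q).
  assert (0 < gw i p * gw j q) by nra.
  replace (gw i p * gw j q * bin p q * (bin i j * bin p q)) with
    (bin i j * bin p q * bin p q * (gw i p * gw j q)) by ring.
  apply Rmult_le_compat_r; lra.
Qed.

(** The weight is of order two in time, whereas the binomial coefficients of the
    Leibniz rule have order one. What is left over is summable ([sum_inv_bin]), so
    that convolution in time costs a constant only. *)
Lemma gw_conv i j n :
  sum_f_R0 (fun p => gw i p * gw j (n - p)) n <= 4 * gw (i + j) n.
Proof.
  eapply Rle_trans.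
  { apply (sum_Rle _ (fun p => / bin p (n - p) * gw (i + j) n) n). intros p hp.
    pose proof (gw_mul i j p (n - p)) as h. pose proof (bin_pos p (n - p)) as hb.
    replace (p + (n - p))%nat with n in h by lia.
    apply Rmult_le_reg_r with (bin p (n - p)); [exact hb|].
    eapply Rle_trans; [exact h|]. right. field. lra. }
  rewrite <- scal_sum, Rmult_comm. apply Rmult_le_compat_r.
  - apply Rlt_le, gw_pos.
  - apply sum_inv_bin.
Qed.

(** * Derivatives with a uniform quadratic remainder *)

(** Every function met below has bounded second derivatives on its interval, so
    that differentiability holds with a remainder uniformly quadratic in the
    increment. In this form it needs no limits, makes no exception for the end
    points and passes to series term by term. *)
Definition qdiff (a b M : R) (f g : R -> C) : Prop :=
  forall x y, in_segment a b x -> in_segment a b y ->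
    Cmod (f y - f x - RtoC (y - x) * g x) <= M * (y - x) ^ 2.

Definition qder (a b : R) (f g : R -> C) : Prop := exists M, qdiff a b M f g.

Lemma qder_ext a b f g f' g' :
  (forall t, in_segment a b t -> f t = f' t) ->
  (forall t, in_segment a b t -> g t = g' t) ->
  qder a b f g -> qder a b f' g'.
Proof.
  intros hf hg [M h]. exists M. intros x y hx hy.
  rewrite <- !hf, <- hg by assumption. apply h; assumption.
Qed.

Lemma qder_const a b c : qder a b (fun _ => c) (fun _ => RtoC 0).
Proof.
  exists 0. intros x y _ _.
  replace (c - c - RtoC (y - x) * RtoC 0)%C with (RtoC 0) by ring.
  rewrite Cmod_0. lra.
Qed.

Lemma qder_id a b : qder a b RtoC (fun _ => RtoC 1).
Proof.
  exists 0. intros x y _ _.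
  replace (RtoC y - RtoC x - RtoC (y - x) * RtoC 1)%C with (RtoC 0).
  - rewrite Cmod_0. lra.
  - rewrite RtoC_minus. ring.
Qed.

Lemma qder_plus a b f g f' g' : qder a b f f' -> qder a b g g' ->
  qder a b (fun t => f t + g t)%C (fun t => f' t + g' t)%C.
Proof.
  intros [M hf] [N hg]. exists (M + N). intros x y hx hy.
  replace (f y + g y - (f x + g x) - RtoC (y - x) * (f' x + g' x))%C with
    ((f y - f x - RtoC (y - x) * f' x) + (g y - g x - RtoC (y - x) * g' x))%C by ring.
  eapply Rle_trans; [apply Cmod_triangle|].
  specialize (hf x y hx hy). specialize (hg x y hx hy). lra.
Qed.

Lemma qder_scal a b c f f' : qder a b f f' ->
  qder a b (fun t => c * f t)%C (fun t => c * f' t)%C.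
Proof.
  intros [M hf]. exists (Cmod c * M). intros x y hx hy.
  replace (c * f y - c * f x - RtoC (y - x) * (c * f' x))%C with
    (c * (f y - f x - RtoC (y - x) * f' x))%C by ring.
  rewrite Cmod_mult, Rmult_assoc. apply Rmult_le_compat_l; [apply Cmod_ge_0|].
  apply hf; assumption.
Qed.

Lemma qder_minus a b f g f' g' : qder a b f f' -> qder a b g g' ->
  qder a b (fun t => f t - g t)%C (fun t => f' t - g' t)%C.
Proof.
  intros hf hg. apply (qder_scal a b (-(1))%C) in hg.
  eapply qder_ext; [| |exact (qder_plus _ _ _ _ _ _ hf hg)]; intros; simpl; ring.
Qed.

Lemma qder_conj a b f f' : qder a b f f' ->
  qder a b (fun t => Cconj (f t)) (fun t => Cconj (f' t)).
Proof.
  intros [M hf]. exists M. intros x y hx hy.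
  replace (Cconj (f y) - Cconj (f x) - RtoC (y - x) * Cconj (f' x))%C with
    (Cconj (f y - f x - RtoC (y - x) * f' x)).
  - rewrite Cmod_conj. apply hf; assumption.
  - rewrite !Cminus_conj, Cmult_conj. f_equal. f_equal.
    unfold Cconj, RtoC. simpl. f_equal. ring.
Qed.

Lemma qder_reflect T f f' : qder 0 T f f' ->
  qder 0 T (fun t => f (T - t)%R) (fun t => - f' (T - t)%R)%C.
Proof.
  intros [M hf]. exists M. intros x y hx hy.
  replace ((y - x) ^ 2) with ((T - y - (T - x)) ^ 2) by ring.
  replace (f (T - y)%R - f (T - x)%R - RtoC (y - x) * - f' (T - x)%R)%C with
    (f (T - y)%R - f (T - x)%R - RtoC (T - y - (T - x)) * f' (T - x)%R)%C.
  - apply (hf (T - x) (T - y)); unfold in_segment in *; lra.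
  - rewrite !RtoC_minus. ring.
Qed.

Lemma RtoC_neq_0 x : x <> 0 -> RtoC x <> RtoC 0.
Proof. intros h e. apply h, RtoC_inj, e. Qed.

Lemma Cmod_minus_le (u v : C) : Cmod u <= Cmod (u - v) + Cmod v.
Proof.
  replace u with (u - v + v)%C at 1 by ring. apply Cmod_triangle.
Qed.

Lemma qder_derivative_bounded a b f f' : qder a b f f' -> exists B, 0 <= B /\
  forall x, in_segment a b x -> Cmod (f' x) <= B.
Proof.
  intros [M hf]. unfold in_segment.
  destruct (Rtotal_order a b) as [hab|[<-|hab]].
  - set (B := Cmod (f b - f a) + 2 * (Rabs M * (b - a) ^ 2)).
    assert (hM : 0 <= Rabs M) by apply Rabs_pos.
    assert (hsq : 0 <= (b - a) ^ 2) by apply pow2_ge_0.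
    assert (hB : 0 <= B).
    { unfold B. pose proof (Cmod_ge_0 (f b - f a)). nra. }
    exists (B / (b - a)). split; [apply Rdiv_le_0_compat; lra|].
    intros x hx. apply -> Rle_div_r; [|lra].
    rewrite <- (Rabs_pos_eq (b - a)), <- Cmod_R, <- Cmod_mult by lra.
    assert (hr : forall y, a <= y <= b ->
      Cmod (f y - f x - RtoC (y - x) * f' x) <= Rabs M * (b - a) ^ 2).
    { intros y hy. eapply Rle_trans; [apply hf; exact hx || exact hy|].
      apply Rle_trans with (Rabs M * (y - x) ^ 2).
      - apply Rmult_le_compat_r; [apply pow2_ge_0|apply Rle_abs].
      - apply Rmult_le_compat_l; [lra|nra]. }
    replace (f' x * RtoC (b - a))%C with
      ((f b - f a) + - (f b - f x - RtoC (b - x) * f' x)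
        + (f a - f x - RtoC (a - x) * f' x))%C
      by (rewrite !RtoC_minus; ring).
    eapply Rle_trans; [apply Cmod_triangle|].
    eapply Rle_trans; [apply Rplus_le_compat_r, Cmod_triangle|].
    rewrite Cmod_opp. unfold B.
    pose proof (hr a ltac:(lra)). pose proof (hr b ltac:(lra)). lra.
  - exists (Cmod (f' a)). split; [apply Cmod_ge_0|].
    intros x hx. replace x with a by lra. lra.
  - exists 0. split; [lra|]. intros; lra.
Qed.

Lemma qder_Lipschitz a b f f' : qder a b f f' -> exists L, 0 <= L /\
  forall x y, in_segment a b x -> in_segment a b y ->
    Cmod (f y - f x) <= L * Rabs (y - x).
Proof.
  intros h. destruct (qder_derivative_bounded _ _ _ _ h) as [B [hB hf']].
  destruct h as [M hf].
  destruct (Rlt_le_dec b a) as [hba|hab].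
  { exists 0. split; [lra|]. unfold in_segment. intros; lra. }
  exists (B + Rabs M * (b - a)).
  assert (hM : 0 <= Rabs M) by apply Rabs_pos.
  split; [nra|].
  intros x y hx hy. specialize (hf x y hx hy). specialize (hf' x hx).
  eapply Rle_trans; [apply (Cmod_minus_le _ (RtoC (y - x) * f' x))|].
  rewrite Cmod_mult, Cmod_R.
  assert (h2 : M * (y - x) ^ 2 <= Rabs M * (b - a) * Rabs (y - x)).
  { rewrite <- (pow2_abs (y - x)).
    assert (hyx : Rabs (y - x) <= b - a)
      by (unfold in_segment in *; apply Rabs_le; lra).
    pose proof (Rabs_pos (y - x)).
    apply Rle_trans with (Rabs M * (Rabs (y - x) * Rabs (y - x))).
    - replace (Rabs (y - x) * Rabs (y - x)) with (Rabs (y - x) ^ 2) by ring.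
      apply Rmult_le_compat_r; [nra|apply Rle_abs].
    - rewrite Rmult_assoc. apply Rmult_le_compat_l; nra. }
  pose proof (Rabs_pos (y - x)). nra.
Qed.

Lemma qder_bounded a b f f' : qder a b f f' -> exists B, 0 <= B /\
  forall x, in_segment a b x -> Cmod (f x) <= B.
Proof.
  intros h. destruct (qder_Lipschitz _ _ _ _ h) as [L [hL h']].
  exists (L * Rabs (b - a) + Cmod (f a)). split.
  { pose proof (Cmod_ge_0 (f a)). pose proof (Rabs_pos (b - a)). nra. }
  intros x hx. eapply Rle_trans; [apply (Cmod_minus_le _ (f a))|].
  apply Rplus_le_compat_r. unfold in_segment in hx.
  eapply Rle_trans; [apply h'; unfold in_segment; lra|].
  apply Rmult_le_compat_l; [exact hL|].
  rewrite !Rabs_pos_eq; lra.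
Qed.

Lemma qder_mult a b f g f' g' : qder a b f f' -> qder a b g g' ->
  qder a b (fun t => f t * g t)%C (fun t => f' t * g t + f t * g' t)%C.
Proof.
  intros hf hg. destruct (qder_derivative_bounded _ _ _ _ hf) as [B' [hB' hf']].
  destruct (qder_bounded _ _ _ _ hf) as [Bf [hBf hbf]].
  destruct (qder_bounded _ _ _ _ hg) as [Bg [hBg hbg]].
  destruct (qder_Lipschitz _ _ _ _ hg) as [L [hL hlg]].
  destruct hf as [M hf]. destruct hg as [N hg].
  exists (Rabs M * Bg + Bf * Rabs N + B' * L). intros x y hx hy.
  replace (f y * g y - f x * g x - RtoC (y - x) * (f' x * g x + f x * g' x))%C with
    ((f y - f x - RtoC (y - x) * f' x) * g y
     + f x * (g y - g x - RtoC (y - x) * g' x)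
     + RtoC (y - x) * f' x * (g y - g x))%C by ring.
  eapply Rle_trans; [apply Cmod_triangle|].
  eapply Rle_trans; [apply Rplus_le_compat_r, Cmod_triangle|].
  rewrite !Cmod_mult, Cmod_R.
  specialize (hf x y hx hy). specialize (hg x y hx hy).
  specialize (hbf x hx). specialize (hbg y hy). specialize (hlg x y hx hy).
  specialize (hf' x hx).
  set (q := (y - x) ^ 2) in *. assert (hq : 0 <= q) by apply pow2_ge_0.
  assert (hq' : q = Rabs (y - x) * Rabs (y - x)).
  { unfold q. rewrite <- (pow2_abs (y - x)). ring. }
  assert (hMq : M * q <= Rabs M * q) by (apply Rmult_le_compat_r; [lra|apply Rle_abs]).
  assert (hNq : N * q <= Rabs N * q) by (apply Rmult_le_compat_r; [lra|apply Rle_abs]).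
  pose proof (Rabs_pos (y - x)) as hd. pose proof (Rabs_pos M). pose proof (Rabs_pos N).
  assert (h1 : Cmod (f y - f x - RtoC (y - x) * f' x) * Cmod (g y) <= Rabs M * q * Bg).
  { apply Rmult_le_compat; try apply Cmod_ge_0; lra. }
  assert (h2 : Cmod (f x) * Cmod (g y - g x - RtoC (y - x) * g' x) <= Bf * (Rabs N * q)).
  { apply Rmult_le_compat; try apply Cmod_ge_0; lra. }
  assert (h3 : Rabs (y - x) * Cmod (f' x) * Cmod (g y - g x) <= (Rabs (y - x) * B') * (L * Rabs (y - x))).
  { apply Rmult_le_compat; try apply Cmod_ge_0; try lra.
    - apply Rmult_le_pos; [lra|apply Cmod_ge_0].
    - apply Rmult_le_compat_l; lra. }
  replace ((Rabs (y - x) * B') * (L * Rabs (y - x))) with (B' * L * q) in h3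
    by (rewrite hq'; ring).
  lra.
Qed.

(** Halving the interval [n] times divides the quadratic remainder by [2 ^ n]. *)
Lemma qder_mean_value a b f f' B : qder a b f f' ->
  (forall x, in_segment a b x -> Cmod (f' x) <= B) ->
  forall x y, in_segment a b x -> in_segment a b y ->
    Cmod (f y - f x) <= B * Rabs (y - x).
Proof.
  intros [M hf] hB.
  assert (key : forall n x y, in_segment a b x -> in_segment a b y ->
    Cmod (f y - f x) <= B * Rabs (y - x) + M * (y - x) ^ 2 / 2 ^ n).
  { induction n as [|n IH]; intros x y hx hy.
    - eapply Rle_trans; [apply (Cmod_minus_le _ (RtoC (y - x) * f' x))|].
      specialize (hf x y hx hy). specialize (hB x hx).
      rewrite Cmod_mult, Cmod_R. pose proof (Rabs_pos (y - x)). simpl in *. nra.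
    - set (m := (x + y) / 2).
      assert (hm : in_segment a b m) by (unfold m, in_segment in *; lra).
      replace (f y - f x)%C with ((f y - f m) + (f m - f x))%C by ring.
      eapply Rle_trans; [apply Cmod_triangle|].
      pose proof (IH x m hx hm) as h1. pose proof (IH m y hm hy) as h2.
      replace (y - m) with ((y - x) / 2) in h2 by (unfold m; field).
      replace (m - x) with ((y - x) / 2) in h1 by (unfold m; field).
      replace (Rabs ((y - x) / 2)) with (Rabs (y - x) / 2) in h1, h2
        by (unfold Rdiv; rewrite Rabs_mult, (Rabs_pos_eq (/ 2)); lra).
      replace (M * (y - x) ^ 2 / 2 ^ S n) with
        (M * ((y - x) / 2) ^ 2 / 2 ^ n + M * ((y - x) / 2) ^ 2 / 2 ^ n).
      + lra.
      + simpl. field. apply pow_nonzero. lra. }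
  intros x y hx hy. apply le_epsilon. intros eps heps.
  set (c := M * (y - x) ^ 2).
  destruct (pow_lt_1_zero (/2) ltac:(rewrite Rabs_pos_eq; lra) (eps / (Rabs c + 1)))
    as [n hn].
  { apply Rdiv_lt_0_compat; [lra|]. pose proof (Rabs_pos c). lra. }
  specialize (hn n (le_n n)). specialize (key n x y hx hy). fold c in key.
  rewrite Rabs_pos_eq in hn by (apply pow_le; lra). rewrite pow_inv in hn.
  assert (c / 2 ^ n <= eps); [|lra].
  pose proof (Rabs_pos c). pose proof (Rle_abs c).
  assert (0 < / 2 ^ n) by (apply Rinv_0_lt_compat, pow_lt; lra).
  unfold Rdiv. apply Rle_trans with ((Rabs c + 1) * / 2 ^ n).
  - apply Rmult_le_compat_r; lra.
  - apply Rle_trans with ((Rabs c + 1) * (eps / (Rabs c + 1))).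
    + apply Rmult_le_compat_l; lra.
    + right. field. lra.
Qed.

(** A bound on the second derivative controls the remainder, whatever constant it
    was first known with; this is what makes termwise differentiation possible. *)
Lemma qdiff_improve a b f f' f'' B : qder a b f f' -> qder a b f' f'' ->
  (forall x, in_segment a b x -> Cmod (f'' x) <= B) -> qdiff a b B f f'.
Proof.
  intros hf hf' hB x y hx hy.
  assert (hsub : forall lo hi, in_segment a b lo -> in_segment a b hi ->
    in_segment lo hi x -> in_segment lo hi y -> hi - lo = Rabs (y - x) ->
    Cmod (f y - f x - RtoC (y - x) * f' x) <= B * (y - x) ^ 2).
  { intros lo hi hlo hhi hx' hy' hd.
    set (h := fun z => (f z - RtoC z * f' x)%C).
    set (h' := fun z => (f' z - f' x)%C).
    assert (hh : qder lo hi h h').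
    { destruct hf as [M hf]. exists M. intros u v hu hv. unfold h, h'.
      replace (f v - RtoC v * f' x - (f u - RtoC u * f' x)
               - RtoC (v - u) * (f' u - f' x))%C with
        (f v - f u - RtoC (v - u) * f' u)%C by (rewrite RtoC_minus; ring).
      apply hf; unfold in_segment in *; lra. }
    assert (hB0 : 0 <= B) by (eapply Rle_trans; [apply Cmod_ge_0|apply (hB x hx)]).
    pose proof (qder_mean_value lo hi h h' (B * Rabs (y - x)) hh) as hmv.
    specialize (fun H => hmv H x y hx' hy').
    unfold h in hmv.
    replace (f y - RtoC y * f' x - (f x - RtoC x * f' x))%C with
      (f y - f x - RtoC (y - x) * f' x)%C in hmv by (rewrite RtoC_minus; ring).
    replace (B * (y - x) ^ 2) with (B * Rabs (y - x) * Rabs (y - x)).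
    - apply hmv. intros z hz. unfold h'.
      assert (hz' : in_segment a b z) by (unfold in_segment in *; lra).
      eapply Rle_trans; [apply (qder_mean_value a b f' f'' B hf' hB x z hx hz')|].
      apply Rmult_le_compat_l; [exact hB0|]. rewrite <- hd.
      unfold in_segment in *. apply Rabs_le. lra.
    - rewrite <- (pow2_abs (y - x)). ring. }
  unfold in_segment in *. destruct (Rle_dec x y) as [hxy|hxy].
  - apply (hsub x y); try lra. rewrite Rabs_pos_eq; lra.
  - apply (hsub y x); try lra. rewrite Rabs_left; lra.
Qed.

(** * Normalised jets *)

(** [F n] plays the role of the derivative of order [n] divided by [n!]: Leibniz'
    rule is then a plain convolution. *)
Definition njet (a b : R) (F : nat -> R -> C) : Prop :=
  forall n, qder a b (F n) (fun t => RtoC (INR (S n)) * F (S n) t)%C.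

Fixpoint csum (f : nat -> C) (n : nat) : C :=
  match n with O => f O | S m => (csum f m + f (S m))%C end.

Definition conv (f g : nat -> C) (n : nat) : C :=
  csum (fun p => f p * g (n - p)%nat)%C n.

Lemma csum_ext f g n : (forall i, (i <= n)%nat -> f i = g i) -> csum f n = csum g n.
Proof.
  induction n as [|n IH]; intros h; simpl; [apply h; lia|].
  rewrite IH by (intros; apply h; lia). rewrite h by lia. reflexivity.
Qed.

Lemma csum_plus f g n : csum (fun i => f i + g i)%C n = (csum f n + csum g n)%C.
Proof. induction n as [|n IH]; simpl; [reflexivity|]. rewrite IH. ring. Qed.

Lemma csum_scal c f n : csum (fun i => c * f i)%C n = (c * csum f n)%C.
Proof. induction n as [|n IH]; simpl; [reflexivity|]. rewrite IH. ring. Qed.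

Lemma csum_0 f n : (forall i, (i <= n)%nat -> f i = RtoC 0) -> csum f n = RtoC 0.
Proof.
  induction n as [|n IH]; intros h; simpl; [apply h; lia|].
  rewrite IH by (intros; apply h; lia). rewrite h by lia. ring.
Qed.

Lemma csum_first f n : csum f (S n) = (f O + csum (fun i => f (S i)) n)%C.
Proof. induction n as [|n IH]; [reflexivity|]. simpl in *. rewrite IH. ring. Qed.

Lemma Cmod_csum f n : Cmod (csum f n) <= sum_f_R0 (fun i => Cmod (f i)) n.
Proof.
  induction n as [|n IH]; simpl; [lra|].
  eapply Rle_trans; [apply Cmod_triangle|]. lra.
Qed.

Lemma Cmod_csum_le f g n : (forall i, (i <= n)%nat -> Cmod (f i) <= g i) ->
  Cmod (csum f n) <= sum_f_R0 g n.
Proof. intros h. eapply Rle_trans; [apply Cmod_csum|]. apply sum_Rle. exact h. Qed.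

Lemma qder_csum a b (f f' : nat -> R -> C) n :
  (forall i, (i <= n)%nat -> qder a b (f i) (f' i)) ->
  qder a b (fun t => csum (fun i => f i t) n) (fun t => csum (fun i => f' i t) n).
Proof.
  induction n as [|n IH]; intros h; simpl; [apply h; lia|].
  apply qder_plus; [apply IH; intros; apply h; lia|apply h; lia].
Qed.

(** Differentiating a convolution raises one of the two indices; each term of order
    [n + 1] is reached from both sides, with multiplicities adding up to [n + 1]. *)
Lemma conv_derivative f g n :
  csum (fun p => RtoC (INR (S p)) * f (S p) * g (n - p)%nat
                 + f p * (RtoC (INR (S (n - p))) * g (S (n - p))))%C n
  = (RtoC (INR (S n)) * conv f g (S n))%C.
Proof.
  unfold conv. rewrite csum_plus, <- csum_scal.
  rewrite (csum_ext (fun i => RtoC (INR (S n)) * (f i * g (S n - i)%nat))%C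
    (fun i => RtoC (INR i) * f i * g (S n - i)%nat
              + RtoC (INR (S n - i)) * f i * g (S n - i)%nat)%C (S n)).
  2:{ intros i hi. rewrite minus_INR, RtoC_minus by exact hi. ring. }
  rewrite csum_plus. f_equal.
  - rewrite csum_first. simpl (INR 0).
    change (csum (fun i => RtoC (INR (S i)) * f (S i) * g (S n - S i)%nat)%C n) with
      (csum (fun p => RtoC (INR (S p)) * f (S p) * g (n - p)%nat)%C n).
    ring.
  - cbn [csum]. rewrite Nat.sub_diag. simpl (INR 0).
    rewrite (csum_ext (fun p => RtoC (INR (S n - p)) * f p * g (S n - p)%nat)%C
      (fun p => f p * (RtoC (INR (S (n - p))) * g (S (n - p))))%C n).
    2:{ intros i hi. replace (S n - i)%nat with (S (n - i)) by lia. ring. }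
    ring.
Qed.

Lemma njet_conv a b F G : njet a b F -> njet a b G ->
  njet a b (fun n t => conv (fun p => F p t) (fun p => G p t) n).
Proof.
  intros hF hG n.
  eapply qder_ext; [intros; reflexivity| |].
  { intros t _. apply (conv_derivative (fun p => F p t) (fun p => G p t) n). }
  unfold conv. apply qder_csum. intros p hp.
  apply qder_mult; [apply hF|apply hG].
Qed.

Lemma njet_plus a b F G : njet a b F -> njet a b G ->
  njet a b (fun n t => F n t + G n t)%C.
Proof.
  intros hF hG n.
  eapply qder_ext; [| |exact (qder_plus _ _ _ _ _ _ (hF n) (hG n))];
    intros; simpl; ring.
Qed.

Lemma njet_scal a b c F : njet a b F -> njet a b (fun n t => c * F n t)%C.
Proof.
  intros hF n.
  eapply qder_ext; [| |exact (qder_scal _ _ c _ _ (hF n))]; intros; simpl; ring.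
Qed.

Lemma njet_conj a b F : njet a b F -> njet a b (fun n t => Cconj (F n t)).
Proof.
  intros hF n.
  eapply qder_ext; [| |exact (qder_conj _ _ _ _ (hF n))]; intros; simpl; [reflexivity|].
  rewrite Cmult_conj. f_equal. unfold Cconj, RtoC. simpl. f_equal. ring.
Qed.

Lemma njet_csum a b (F : nat -> nat -> R -> C) k :
  (forall i, (i <= k)%nat -> njet a b (F i)) ->
  njet a b (fun n t => csum (fun i => F i n t) k).
Proof.
  intros hF n.
  eapply qder_ext; [intros; reflexivity| |].
  { intros t _. apply csum_scal. }
  apply qder_csum. intros i hi. apply hF, hi.
Qed.

Lemma njet_reflect T F : njet 0 T F ->
  njet 0 T (fun n t => RtoC ((-1) ^ n) * F n (T - t)%R)%C.
Proof.
  intros hF n.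
  eapply qder_ext; [| |exact (qder_scal _ _ (RtoC ((-1) ^ n)) _ _
    (qder_reflect _ _ _ (hF n)))]; intros t _; cbv beta; [reflexivity|].
  replace ((-1) ^ S n) with (- (-1) ^ n) by (simpl; ring).
  rewrite RtoC_opp. ring.
Qed.

(** * Absolutely convergent complex series *)

(** Summation is componentwise, to inherit the theory of real series; the modulus
    of a sum is then controlled up to a harmless factor [2]. *)
Definition is_csum (a : nat -> C) (l : C) : Prop :=
  is_series (fun n => fst (a n)) (fst l) /\ is_series (fun n => snd (a n)) (snd l).

Definition Csum (a : nat -> C) : C :=
  (Series (fun n => fst (a n)), Series (fun n => snd (a n))).

Definition csummable (a : nat -> C) : Prop := ex_series (fun n => Cmod (a n)).

Lemma Rabs_fst_le (z : C) : Rabs (fst z) <= Cmod z.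
Proof. eapply Rle_trans; [apply Rmax_l|apply Rmax_Cmod]. Qed.

Lemma Rabs_snd_le (z : C) : Rabs (snd z) <= Cmod z.
Proof. eapply Rle_trans; [apply Rmax_r|apply Rmax_Cmod]. Qed.

Lemma Cmod_le_parts (z : C) : Cmod z <= Rabs (fst z) + Rabs (snd z).
Proof.
  destruct z as [x y]. replace (x, y) with (RtoC x + Ci * RtoC y)%C.
  - eapply Rle_trans; [apply Cmod_triangle|].
    rewrite Cmod_mult, Cmod_Ci, !Cmod_R. simpl.
    replace (x + (0 * y - 1 * 0)) with x by ring.
    replace (0 + (0 * 0 + 1 * y)) with y by ring. lra.
  - unfold RtoC, Ci, Cplus, Cmult. simpl. f_equal; ring.
Qed.

Lemma ex_series_dominated (a b : nat -> R) :
  (forall n, Rabs (a n) <= b n) -> ex_series b -> ex_series a.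
Proof. intros h hb. exact (ex_series_le (V := R_CompleteNormedModule) a b h hb). Qed.

Lemma csummable_le a b : (forall n, Cmod (a n) <= b n) -> ex_series b -> csummable a.
Proof.
  intros h. apply ex_series_dominated. intros n.
  rewrite Rabs_pos_eq by apply Cmod_ge_0. apply h.
Qed.

Lemma csummable_fst_abs a : csummable a -> ex_series (fun n => Rabs (fst (a n))).
Proof.
  apply ex_series_dominated. intros n. rewrite Rabs_Rabsolu. apply Rabs_fst_le.
Qed.

Lemma csummable_snd_abs a : csummable a -> ex_series (fun n => Rabs (snd (a n))).
Proof.
  apply ex_series_dominated. intros n. rewrite Rabs_Rabsolu. apply Rabs_snd_le.
Qed.

Lemma Csum_correct a : csummable a -> is_csum a (Csum a).
Proof.
  intros h. split; apply Series_correct, ex_series_Rabs;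
    [apply csummable_fst_abs, h|apply csummable_snd_abs, h].
Qed.

Lemma is_csum_unique a l : is_csum a l -> Csum a = l.
Proof.
  intros [h1 h2]. unfold Csum.
  rewrite (is_series_unique _ _ h1), (is_series_unique _ _ h2).
  symmetry. apply surjective_pairing.
Qed.

Lemma is_csum_ext a b l : (forall n, a n = b n) -> is_csum a l -> is_csum b l.
Proof.
  intros h [h1 h2]. split; [eapply is_series_ext; [|exact h1]|eapply is_series_ext; [|exact h2]];
    intros n; simpl; rewrite h; reflexivity.
Qed.

Lemma Csum_bound a b : (forall n, Cmod (a n) <= b n) -> ex_series b ->
  Cmod (Csum a) <= 2 * Series b.
Proof.
  intros h hb. eapply Rle_trans; [apply Cmod_le_parts|]. unfold Csum. simpl.
  pose proof (csummable_le a b h hb) as hs.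
  assert (h1 : Rabs (Series (fun n => fst (a n))) <= Series b).
  { eapply Rle_trans; [apply Series_Rabs, csummable_fst_abs, hs|].
    apply Series_le; [|exact hb]. intros n. split; [apply Rabs_pos|].
    eapply Rle_trans; [apply Rabs_fst_le|apply h]. }
  assert (h2 : Rabs (Series (fun n => snd (a n))) <= Series b).
  { eapply Rle_trans; [apply Series_Rabs, csummable_snd_abs, hs|].
    apply Series_le; [|exact hb]. intros n. split; [apply Rabs_pos|].
    eapply Rle_trans; [apply Rabs_snd_le|apply h]. }
  lra.
Qed.

Lemma is_csum_plus a b la lb : is_csum a la -> is_csum b lb ->
  is_csum (fun n => a n + b n)%C (la + lb)%C.
Proof.
  intros [h1 h2] [h3 h4]. split.
  - exact (is_series_plus _ _ _ _ h1 h3).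
  - exact (is_series_plus _ _ _ _ h2 h4).
Qed.

Lemma is_csum_scal c a l : is_csum a l -> is_csum (fun n => c * a n)%C (c * l)%C.
Proof.
  intros [h1 h2]. split.
  - exact (is_series_minus _ _ _ _ (is_series_scal (fst c) _ _ h1)
      (is_series_scal (snd c) _ _ h2)).
  - exact (is_series_plus _ _ _ _ (is_series_scal (fst c) _ _ h2)
      (is_series_scal (snd c) _ _ h1)).
Qed.

Lemma is_csum_conj a l : is_csum a l -> is_csum (fun n => Cconj (a n)) (Cconj l).
Proof. intros [h1 h2]. split; [exact h1|]. exact (is_series_opp _ _ h2). Qed.

Lemma fst_conv a b n : fst (conv a b n) =
  sum_f_R0 (fun k => fst (a k) * fst (b (n - k)%nat)) n
  - sum_f_R0 (fun k => snd (a k) * snd (b (n - k)%nat)) n.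
Proof.
  unfold conv. rewrite <- minus_sum.
  assert (h : forall f m, fst (csum f m) = sum_f_R0 (fun k => fst (f k)) m).
  { intros f m. induction m as [|m IH]; simpl; [reflexivity|]. rewrite IH. reflexivity. }
  rewrite h. reflexivity.
Qed.

Lemma snd_conv a b n : snd (conv a b n) =
  sum_f_R0 (fun k => fst (a k) * snd (b (n - k)%nat)) n
  + sum_f_R0 (fun k => snd (a k) * fst (b (n - k)%nat)) n.
Proof.
  unfold conv. rewrite <- plus_sum.
  assert (h : forall f m, snd (csum f m) = sum_f_R0 (fun k => snd (f k)) m).
  { intros f m. induction m as [|m IH]; simpl; [reflexivity|]. rewrite IH. reflexivity. }
  rewrite h. reflexivity.
Qed.

Lemma is_csum_conv a b la lb : is_csum a la -> is_csum b lb ->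
  csummable a -> csummable b -> is_csum (conv a b) (la * lb)%C.
Proof.
  intros [h1 h2] [h3 h4] ha hb.
  pose proof (csummable_fst_abs a ha). pose proof (csummable_snd_abs a ha).
  pose proof (csummable_fst_abs b hb). pose proof (csummable_snd_abs b hb).
  split.
  - eapply is_series_ext; [intros n; symmetry; apply fst_conv|].
    exact (is_series_minus _ _ _ _ (is_series_mult _ _ _ _ h1 h3 ltac:(assumption) ltac:(assumption))
      (is_series_mult _ _ _ _ h2 h4 ltac:(assumption) ltac:(assumption))).
  - eapply is_series_ext; [intros n; symmetry; apply snd_conv|].
    exact (is_series_plus _ _ _ _ (is_series_mult _ _ _ _ h1 h4 ltac:(assumption) ltac:(assumption))
      (is_series_mult _ _ _ _ h2 h3 ltac:(assumption) ltac:(assumption))).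
Qed.

Lemma csummable_conv a b : csummable a -> csummable b -> csummable (conv a b).
Proof.
  intros [la ha] [lb hb].
  apply (csummable_le _
    (fun n => sum_f_R0 (fun k => Cmod (a k) * Cmod (b (n - k)%nat)) n)).
  - intros n. apply Cmod_csum_le. intros i _. rewrite Cmod_mult. lra.
  - exists (la * lb).
    apply (is_series_mult (fun n => Cmod (a n)) (fun n => Cmod (b n)));
      try assumption; (eapply ex_series_ext; [intros n; symmetry; apply Rabs_pos_eq, Cmod_ge_0|]);
      eexists; eassumption.
Qed.

Lemma ex_series_scal_l (c : R) (b : nat -> R) : ex_series b -> ex_series (fun n => c * b n).
Proof. intros h. exact (ex_series_scal (K := R_AbsRing) c b h). Qed.

Lemma Series_pos (b : nat -> R) : (forall n, 0 <= b n) -> ex_series b -> 0 <= Series b.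
Proof.
  intros h hb. replace 0 with (Series (fun n => 0 * b n)).
  - apply Series_le; [|exact hb]. intros n. specialize (h n). lra.
  - rewrite Series_scal_l. ring.
Qed.

(** The quadratic remainder of a term at order [n] is controlled by its bound at
    order [n + 2] ([qdiff_improve]), hence the remainders are summable too. *)
Lemma njet_Csum a b (F : nat -> nat -> R -> C) (beta : nat -> nat -> R) :
  (forall k, njet a b (F k)) ->
  (forall k n t, in_segment a b t -> Cmod (F k n t) <= beta k n) ->
  (forall n, ex_series (fun k => beta k n)) ->
  njet a b (fun n t => Csum (fun k => F k n t)).
Proof.
  intros hF hb hs n.
  assert (hsum : forall m t, in_segment a b t -> csummable (fun k => F k m t)).
  { intros m t ht. apply (csummable_le _ (fun k => beta k m)); [|apply hs].
    intros k. apply hb, ht. }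
  set (c := INR (S n) * INR (S (S n))).
  assert (hc : 0 <= c) by (apply Rmult_le_pos; apply pos_INR).
  exists (2 * Series (fun k => c * beta k (S (S n)) * 1)).
  intros x y hx hy.
  set (q := (y - x) ^ 2). assert (hq : 0 <= q) by apply pow2_ge_0.
  assert (hbd : Cmod (Csum (fun k => F k n y - F k n x
      - RtoC (y - x) * (RtoC (INR (S n)) * F k (S n) x))%C)
    <= 2 * Series (fun k => c * beta k (S (S n)) * q)).
  { apply Csum_bound.
    - intros k. apply (qdiff_improve a b (F k n)
        (fun t => RtoC (INR (S n)) * F k (S n) t)%C
        (fun t => RtoC (INR (S n)) * (RtoC (INR (S (S n))) * F k (S (S n)) t))%C
        (c * beta k (S (S n)))); try assumption.
      + apply hF.
      + apply qder_scal, hF.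
      + intros t ht. rewrite !Cmod_mult, !Cmod_R, !Rabs_pos_eq by apply pos_INR.
        rewrite <- Rmult_assoc. apply Rmult_le_compat_l; [exact hc|apply hb, ht].
    - eapply ex_series_ext; [|apply (ex_series_scal_l (c * q)), (hs (S (S n)))].
      intros k. simpl. ring. }
  assert (he : Csum (fun k => F k n y - F k n x
      - RtoC (y - x) * (RtoC (INR (S n)) * F k (S n) x))%C
    = (Csum (fun k => F k n y) - Csum (fun k => F k n x)
       - RtoC (y - x) * (RtoC (INR (S n)) * Csum (fun k => F k (S n) x)))%C).
  { apply is_csum_unique.
    pose proof (Csum_correct _ (hsum n y hy)) as h1.
    pose proof (is_csum_scal (-(1))%C _ _ (Csum_correct _ (hsum n x hx))) as h2.
    pose proof (is_csum_scal (- (RtoC (y - x) * RtoC (INR (S n))))%C _ _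
      (Csum_correct _ (hsum (S n) x hx))) as h3.
    pose proof (is_csum_plus _ _ _ _ (is_csum_plus _ _ _ _ h1 h2) h3) as h4.
    match type of h4 with is_csum _ ?l => match goal with |- is_csum _ ?l' =>
      replace l' with l by ring end end.
    eapply is_csum_ext; [|exact h4]. intros k. simpl. ring. }
  rewrite <- he. eapply Rle_trans; [exact hbd|]. right.
  rewrite !Series_scal_r. ring.
Qed.

(** * Derivatives relative to a closed interval or rectangle *)

Lemma norm_C_R (z : C) : norm (V := C_R_NormedModule) z = Cmod z.
Proof.
  unfold norm. simpl. unfold prod_norm, Cmod. f_equal.
  unfold norm. simpl. unfold abs. simpl. rewrite !Rmult_1_r.
  rewrite <- !Rabs_mult, !Rabs_pos_eq by apply Rle_0_sqr. reflexivity.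
Qed.

Lemma remainder_C_R (u v l : C) (h : R) :
  minus (G := C_R_NormedModule) (minus (G := C_R_NormedModule) u v)
    (scal (V := C_R_NormedModule) h l) = (u - v - RtoC h * l)%C.
Proof.
  destruct u, v, l. unfold minus, plus, opp, scal. simpl.
  unfold prod_plus, prod_opp, prod_scal, plus, opp, scal. simpl. unfold mult. simpl.
  unfold Cminus, Cplus, Copp, Cmult, RtoC. simpl. f_equal; ring.
Qed.

Lemma is_derive_on_eps a b f x l : in_segment a b x ->
  is_derive_on a b f x l <-> (forall eps, 0 < eps -> exists d, 0 < d /\
    forall y, in_segment a b y -> Rabs (y - x) < d ->
      Cmod (f y - f x - RtoC (y - x) * l) <= eps * Rabs (y - x)).
Proof.
  intros hx. split.
  - intros [_ h] eps heps.
    assert (hlim : is_filter_lim (within (in_segment a b) (locally x)) x).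
    { intros P HP. unfold within. apply filter_imp with (2 := HP). auto. }
    destruct (h x hlim (mkposreal eps heps)) as [d hd].
    exists d. split; [apply cond_pos|]. intros y hy hyx.
    specialize (hd y hyx hy). rewrite remainder_C_R, norm_C_R in hd. exact hd.
  - intros h. split.
    + split.
      * intros u v. apply (scal_distr_r (V := C_R_NormedModule)).
      * intros k u. symmetry. apply (scal_assoc (V := C_R_NormedModule)).
      * exists (Cmod l + 1). split; [pose proof (Cmod_ge_0 l); lra|].
        intros u. rewrite norm_C_R.
        replace (scal (V := C_R_NormedModule) u l) with (RtoC u * l)%C.
        { rewrite Cmod_mult, Cmod_R. change (norm u) with (Rabs u).
          pose proof (Rabs_pos u). pose proof (Cmod_ge_0 l). nra. }
        { destruct l. unfold scal. simpl. unfold prod_scal, scal. simpl. unfold mult.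
          simpl. unfold Cmult, RtoC. simpl. f_equal; ring. }
    + intros x0 hx0.
      assert (x0 = x) as ->.
      { destruct (Req_dec x0 x) as [e|ne]; [exact e|exfalso].
        assert (hpos : 0 < Rabs (x - x0)) by (apply Rabs_pos_lt; lra).
        assert (hl : locally x0 (fun z => Rabs (z - x0) < Rabs (x - x0))).
        { exists (mkposreal _ hpos). intros z hz. exact hz. }
        specialize (hx0 _ hl). apply locally_singleton in hx0.
        specialize (hx0 hx). lra. }
      intros eps. destruct (h eps (cond_pos eps)) as [d [hd hd']].
      exists (mkposreal d hd). intros y hy hyin.
      rewrite remainder_C_R, norm_C_R. apply hd'; assumption.
Qed.

Lemma qder_is_derive_on a b f g x : qder a b f g -> in_segment a b x ->
  is_derive_on a b f x (g x).
Proof.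
  intros [M h] hx. apply is_derive_on_eps; [exact hx|]. intros eps heps.
  exists (eps / (Rabs M + 1)). pose proof (Rabs_pos M) as hM.
  split; [apply Rdiv_lt_0_compat; lra|].
  intros y hy hyx. eapply Rle_trans; [apply h; assumption|].
  rewrite <- (pow2_abs (y - x)). pose proof (Rabs_pos (y - x)) as hd.
  replace (M * Rabs (y - x) ^ 2) with (M * Rabs (y - x) * Rabs (y - x)) by ring.
  apply Rmult_le_compat_r; [exact hd|].
  apply Rle_trans with ((Rabs M + 1) * Rabs (y - x)).
  - apply Rmult_le_compat_r; [exact hd|]. pose proof (Rle_abs M). lra.
  - apply Rle_trans with ((Rabs M + 1) * (eps / (Rabs M + 1))).
    + apply Rmult_le_compat_l; lra.
    + right. field. lra.
Qed.

Lemma is_derive_on_unique a b f x l l' : a < b -> in_segment a b x ->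
  is_derive_on a b f x l -> is_derive_on a b f x l' -> l = l'.
Proof.
  intros hab hx h h'.
  rewrite is_derive_on_eps in h, h' by exact hx.
  assert (hle : Cmod (l - l') <= 0).
  { apply le_epsilon. intros eps heps.
    destruct (h (eps / 2) ltac:(lra)) as [d [hd hd1]].
    destruct (h' (eps / 2) ltac:(lra)) as [d' [hd' hd1']].
    assert (hy : exists y, in_segment a b y /\ 0 < Rabs (y - x) /\
      Rabs (y - x) < d /\ Rabs (y - x) < d').
    { set (e := Rmin (Rmin d d') (b - a) / 2).
      assert (he : 0 < e /\ e < d /\ e < d' /\ e <= (b - a) / 2).
      { unfold e. pose proof (Rmin_l (Rmin d d') (b - a)).
        pose proof (Rmin_r (Rmin d d') (b - a)).
        pose proof (Rmin_l d d'). pose proof (Rmin_r d d').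
        assert (0 < Rmin (Rmin d d') (b - a)) by (repeat apply Rmin_pos; lra). lra. }
      unfold in_segment in *.
      destruct (Rle_dec x ((a + b) / 2)).
      - exists (x + e). replace (x + e - x) with e by ring.
        rewrite Rabs_pos_eq; lra.
      - exists (x - e). replace (x - e - x) with (- e) by ring.
        rewrite Rabs_left; lra. }
    destruct hy as [y [hy [h0 [h1 h2]]]].
    specialize (hd1 y hy h1). specialize (hd1' y hy h2).
    apply Rmult_le_reg_l with (Rabs (y - x)); [exact h0|].
    rewrite <- (Cmod_R (y - x)) at 1. rewrite <- Cmod_mult.
    replace (RtoC (y - x) * (l - l'))%C with
      ((f y - f x - RtoC (y - x) * l') + - (f y - f x - RtoC (y - x) * l))%C by ring.
    eapply Rle_trans; [apply Cmod_triangle|]. rewrite Cmod_opp. lra. }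
  assert (h0 : (l - l')%C = RtoC 0).
  { apply Cmod_eq_0. pose proof (Cmod_ge_0 (l - l')). lra. }
  replace l with ((l - l') + l')%C by ring. rewrite h0. ring.
Qed.

Lemma Derive_on_qder a b f g x : a < b -> qder a b f g -> in_segment a b x ->
  Derive_on a b f x = g x.
Proof.
  intros hab h hx. unfold Derive_on.
  apply (iota_unique (V := C_R_CompleteNormedModule)).
  - intros y hy. exact (is_derive_on_unique a b f x _ _ hab hx hy
      (qder_is_derive_on a b f g x h hx)).
  - exact (qder_is_derive_on a b f g x h hx).
Qed.

Lemma Derive_n_on_njet a b F f n t : a < b -> njet a b F ->
  (forall t, in_segment a b t -> f t = F O t) -> in_segment a b t ->
  Derive_n_on a b n f t = (RtoC (fct n) * F n t)%C.
Proof.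
  intros hab hF hf. revert t. induction n as [|n IH]; intros t ht.
  - simpl. rewrite hf by exact ht. ring.
  - change (Derive_n_on a b (S n) f t) with (Derive_on a b (Derive_n_on a b n f) t).
    rewrite (Derive_on_qder a b _ (fun t => RtoC (fct (S n)) * F (S n) t)%C t hab);
      [reflexivity| |exact ht].
    eapply qder_ext; [| |exact (qder_scal _ _ (RtoC (fct n)) _ _ (hF n))].
    + intros s hs. symmetry. apply IH, hs.
    + intros s _. cbv beta. rewrite fct_S, RtoC_mult, <- S_INR. ring.
Qed.

Lemma fact_pow_1 n : fact_pow n 1 = fct n.
Proof. unfold fact_pow. apply Rpower_1, fct_pos. Qed.

Lemma fact_pow_2 n : fact_pow n 2 = fct n ^ 2.
Proof. unfold fact_pow. replace 2 with (INR 2) at 1 by (simpl; lra). apply Rpower_pow, fct_pos. Qed.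

Lemma gevrey_njet a b F f K r : a < b -> njet a b F ->
  (forall t, in_segment a b t -> f t = F O t) -> 0 < K -> 0 < r ->
  (forall n t, in_segment a b t -> Cmod (F n t) <= K * fct n / r ^ n) ->
  gevrey 2 a b f.
Proof.
  intros hab hF hf hK hr hb. split.
  - intros n x hx. exists (RtoC (fct (S n)) * F (S n) x)%C.
    apply (qder_is_derive_on a b _ (fun t => RtoC (fct (S n)) * F (S n) t)%C);
      [|exact hx].
    eapply qder_ext; [| |exact (qder_scal _ _ (RtoC (fct n)) _ _ (hF n))].
    + intros s hs. symmetry. apply Derive_n_on_njet; assumption.
    + intros s _. cbv beta. rewrite fct_S, RtoC_mult, <- S_INR. ring.
  - exists K, r. repeat split; try assumption. intros n t ht.
    rewrite (Derive_n_on_njet a b F f n t hab hF hf ht), fact_pow_2.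
    rewrite Cmod_mult, Cmod_R, Rabs_pos_eq by apply Rlt_le, fct_pos.
    replace (K * fct n ^ 2 / r ^ n) with (fct n * (K * fct n / r ^ n)).
    + apply Rmult_le_compat_l; [apply Rlt_le, fct_pos|apply hb, ht].
    + field. apply pow_nonzero. lra.
Qed.

(** The analogue of [njet] in two variables, normalised by [p! q!]. The bounds are
    there for joint continuity: they make each [Y p q] Lipschitz. *)
Record bijet (x1 x2 t1 t2 : R) (Y : nat -> nat -> R -> R -> C) : Prop := {
  bijet_x : forall q t, in_segment t1 t2 t -> njet x1 x2 (fun p x => Y p q x t);
  bijet_t : forall p x, in_segment x1 x2 x -> njet t1 t2 (fun q t => Y p q x t);
  bijet_bounded : forall p q, exists B, 0 <= B /\ forall x t,
    in_segment x1 x2 x -> in_segment t1 t2 t -> Cmod (Y p q x t) <= B }.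

Lemma bijet_continuous x1 x2 t1 t2 Y z p q : bijet x1 x2 t1 t2 Y ->
  (forall x t, in_segment x1 x2 x -> in_segment t1 t2 t ->
     z x t = (RtoC (fct p * fct q) * Y p q x t)%C) ->
  continuous_on (T := prod_UniformSpace R_UniformSpace R_UniformSpace)
    (U := C_UniformSpace) (rectangle x1 x2 t1 t2) (fun u => z (fst u) (snd u)).
Proof.
  intros hY hz [x t] [hx ht]. simpl in hx, ht.
  destruct (bijet_bounded _ _ _ _ _ hY (S p) q) as [B1 [hB1 hb1]].
  destruct (bijet_bounded _ _ _ _ _ hY p (S q)) as [B2 [hB2 hb2]].
  set (c := fct p * fct q).
  assert (hc : 0 <= c) by (apply Rmult_le_pos; apply Rlt_le, fct_pos).
  set (L := c * (INR (S p) * B1 + INR (S q) * B2) + 1).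
  assert (hp1 : 0 <= INR (S p) * B1) by (apply Rmult_le_pos; [apply pos_INR|exact hB1]).
  assert (hp2 : 0 <= INR (S q) * B2) by (apply Rmult_le_pos; [apply pos_INR|exact hB2]).
  assert (hL : 0 < L) by (unfold L; nra).
  intros P [eps hP].
  assert (hd : 0 < eps / (L * 2)).
  { apply Rdiv_lt_0_compat; [apply cond_pos|lra]. }
  exists (mkposreal _ hd). intros [x' t'] [hx' ht'] [hxin htin].
  simpl in hx', ht', hxin, htin. apply hP.
  change (Rabs (x' - x) < eps / (L * 2)) in hx'.
  change (Rabs (t' - t) < eps / (L * 2)) in ht'.
  assert (hle : Cmod (z x' t' - z x t) <= L * (Rabs (x' - x) + Rabs (t' - t))).
  { rewrite !hz by assumption. fold c.
    replace (RtoC c * Y p q x' t' - RtoC c * Y p q x t)%C with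
      (RtoC c * ((Y p q x' t' - Y p q x t') + (Y p q x t' - Y p q x t)))%C by ring.
    rewrite Cmod_mult, Cmod_R, Rabs_pos_eq by exact hc.
    assert (e1 : Cmod (Y p q x' t' - Y p q x t') <= INR (S p) * B1 * Rabs (x' - x)).
    { apply (qder_mean_value x1 x2 (fun x => Y p q x t')
        (fun x => RtoC (INR (S p)) * Y (S p) q x t')%C); try assumption.
      - apply (bijet_x _ _ _ _ _ hY q t' htin p).
      - intros u hu. rewrite Cmod_mult, Cmod_R, Rabs_pos_eq by apply pos_INR.
        apply Rmult_le_compat_l; [apply pos_INR|apply hb1; assumption]. }
    assert (e2 : Cmod (Y p q x t' - Y p q x t) <= INR (S q) * B2 * Rabs (t' - t)).
    { apply (qder_mean_value t1 t2 (fun t => Y p q x t)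
        (fun t => RtoC (INR (S q)) * Y p (S q) x t)%C); try assumption.
      - apply (bijet_t _ _ _ _ _ hY p x hx q).
      - intros u hu. rewrite Cmod_mult, Cmod_R, Rabs_pos_eq by apply pos_INR.
        apply Rmult_le_compat_l; [apply pos_INR|apply hb2; assumption]. }
    pose proof (Rabs_pos (x' - x)). pose proof (Rabs_pos (t' - t)).
    eapply Rle_trans; [apply Rmult_le_compat_l; [exact hc|apply Cmod_triangle]|].
    eapply Rle_trans; [apply Rmult_le_compat_l;
      [exact hc|apply Rplus_le_compat; [exact e1|exact e2]]|].
    unfold L.
    set (X := Rabs (x' - x)) in *. set (Z := Rabs (t' - t)) in *.
    set (u1 := INR (S p) * B1) in *. set (u2 := INR (S q) * B2) in *.
    assert (0 <= c * (u1 * Z)) by (apply Rmult_le_pos; [|apply Rmult_le_pos]; assumption).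
    assert (0 <= c * (u2 * X)) by (apply Rmult_le_pos; [|apply Rmult_le_pos]; assumption).
    nra. }
  assert (hlt : Cmod (z x' t' - z x t) < eps).
  { eapply Rle_lt_trans; [exact hle|].
    apply Rlt_le_trans with (L * (eps / (L * 2) + eps / (L * 2))).
    - apply Rmult_lt_compat_l; lra.
    - right. field. lra. }
  split; simpl.
  - eapply Rle_lt_trans; [|exact hlt]. exact (Rabs_fst_le (z x' t' - z x t)).
  - eapply Rle_lt_trans; [|exact hlt]. exact (Rabs_snd_le (z x' t' - z x t)).
Qed.

Section bijet_derivatives.
Context (x1 x2 t1 t2 : R) (hx12 : x1 < x2) (ht12 : t1 < t2)
  (Y : nat -> nat -> R -> R -> C) (hY : bijet x1 x2 t1 t2 Y).

(** Only the values on the rectangle are compared: those of the iterated partial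
    derivatives elsewhere are arbitrary. *)
Definition represents (z : R -> R -> C) (p q : nat) : Prop :=
  forall x t, in_segment x1 x2 x -> in_segment t1 t2 t ->
    z x t = (RtoC (fct p * fct q) * Y p q x t)%C.

Lemma represents_qder_x z p q t : represents z p q -> in_segment t1 t2 t ->
  qder x1 x2 (fun x => z x t) (fun x => RtoC (fct (S p) * fct q) * Y (S p) q x t)%C.
Proof.
  intros hz ht.
  eapply qder_ext; [| |exact (qder_scal _ _ (RtoC (fct p * fct q)) _ _
    (bijet_x _ _ _ _ _ hY q t ht p))].
  - intros x hx. symmetry. apply hz; assumption.
  - intros x _. cbv beta. rewrite fct_S, <- S_INR, !RtoC_mult. ring.
Qed.

Lemma represents_qder_t z p q x : represents z p q -> in_segment x1 x2 x ->
  qder t1 t2 (fun t => z x t) (fun t => RtoC (fct p * fct (S q)) * Y p (S q) x t)%C.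
Proof.
  intros hz hx.
  eapply qder_ext; [| |exact (qder_scal _ _ (RtoC (fct p * fct q)) _ _
    (bijet_t _ _ _ _ _ hY p x hx q))].
  - intros t ht. symmetry. apply hz; assumption.
  - intros t _. cbv beta. rewrite fct_S, <- S_INR, !RtoC_mult. ring.
Qed.

Lemma represents_partial_x z p q : represents z p q ->
  represents (partial_x x1 x2 z) (S p) q.
Proof.
  intros hz x t hx ht. unfold partial_x.
  rewrite (Derive_on_qder _ _ _ _ x hx12 (represents_qder_x z p q t hz ht) hx).
  reflexivity.
Qed.

Lemma represents_partial_t z p q : represents z p q ->
  represents (partial_t t1 t2 z) p (S q).
Proof.
  intros hz x t hx ht. unfold partial_t.
  rewrite (Derive_on_qder _ _ _ _ t ht12 (represents_qder_t z p q x hz hx) ht).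
  reflexivity.
Qed.

Lemma represents_Cn n z p q : represents z p q -> Cn_on x1 x2 t1 t2 n z.
Proof.
  revert z p q. induction n as [|n IH]; intros z p q hz; simpl;
    (split; [exact (bijet_continuous _ _ _ _ Y z p q hY hz)|]); [exact I|].
  split; [|split].
  - intros x t hx ht. split.
    + eexists. exact (qder_is_derive_on _ _ _ _ x (represents_qder_x z p q t hz ht) hx).
    + eexists. exact (qder_is_derive_on _ _ _ _ t (represents_qder_t z p q x hz hx) ht).
  - exact (IH _ _ _ (represents_partial_x z p q hz)).
  - exact (IH _ _ _ (represents_partial_t z p q hz)).
Qed.

Lemma represents_iter z p q : represents z 0 0 ->
  represents (Nat.iter p (partial_x x1 x2) (Nat.iter q (partial_t t1 t2) z)) p q.
Proof.
  intros hz. induction p as [|p IH]; [|exact (represents_partial_x _ _ _ IH)].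
  induction q as [|q IH]; [exact hz|exact (represents_partial_t _ _ _ IH)].
Qed.

Lemma gevrey2_bijet z K r1 r2 : represents z 0 0 -> 0 < K -> 0 < r1 -> 0 < r2 ->
  (forall p q x t, in_segment x1 x2 x -> in_segment t1 t2 t ->
    Cmod (Y p q x t) <= K * fct q / (r1 ^ p * r2 ^ q)) ->
  gevrey2 1 2 x1 x2 t1 t2 z.
Proof.
  intros hz hK h1 h2 hb. split.
  - intros n. exact (represents_Cn n z 0 0 hz).
  - exists K, r1, r2. repeat split; try assumption. intros p q x t hx ht.
    rewrite (represents_iter z p q hz x t hx ht), fact_pow_1, fact_pow_2.
    pose proof (fct_pos p). pose proof (fct_pos q).
    assert (0 <= fct p * fct q) by nra.
    rewrite Cmod_mult, Cmod_R, Rabs_pos_eq by assumption.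
    replace (K * (fct p * fct q ^ 2) / (r1 ^ p * r2 ^ q)) with
      (fct p * fct q * (K * fct q / (r1 ^ p * r2 ^ q))).
    + apply Rmult_le_compat_l; [assumption|apply hb; assumption].
    + field. split; apply pow_nonzero; lra.
Qed.

End bijet_derivatives.

(** * The equation on double power series *)

Definition conv2 (u v : nat -> nat -> C) (k n : nat) : C :=
  csum (fun i => conv (u i) (v (k - i)%nat) n) k.

(** Coefficients of [|y|^2 y = y * y * conj y], the space variable being real. *)
Definition cubic (u : nat -> nat -> C) : nat -> nat -> C :=
  conv2 (conv2 u u) (fun k n => Cconj (u k n)).

Definition solves (th ph : R) (u : nat -> nat -> C) : Prop :=
  forall k n, (RtoC (INR (S n)) * u k (S n)
    = cis th * (RtoC (INR (S k) * INR (S (S k))) * u (S (S k)) n)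
      + cis ph * cubic u k n)%C.

Lemma conv_ext f g f' g' n : (forall p, (p <= n)%nat -> f p = f' p) ->
  (forall p, (p <= n)%nat -> g p = g' p) -> conv f g n = conv f' g' n.
Proof.
  intros hf hg. apply csum_ext. intros p hp. rewrite hf, hg by lia. reflexivity.
Qed.

Lemma conv2_ext u v u' v' k n :
  (forall i p, (i <= k)%nat -> (p <= n)%nat -> u i p = u' i p) ->
  (forall i p, (i <= k)%nat -> (p <= n)%nat -> v i p = v' i p) ->
  conv2 u v k n = conv2 u' v' k n.
Proof.
  intros hu hv. apply csum_ext. intros i hi.
  apply conv_ext; intros p hp; [apply hu|apply hv]; lia.
Qed.

Lemma cubic_ext u v k n :
  (forall i p, (i <= k)%nat -> (p <= n)%nat -> u i p = v i p) ->
  cubic u k n = cubic v k n.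
Proof.
  intros h. unfold cubic. apply conv2_ext.
  - intros i p hi hp. apply conv2_ext; intros; apply h; lia.
  - intros i p hi hp. rewrite h by lia. reflexivity.
Qed.

Lemma weight_pos a b k n : 0 < a -> 0 < b -> 0 < a ^ k * b ^ n * gw k n.
Proof.
  intros ha hb. apply Rmult_lt_0_compat; [|apply gw_pos].
  apply Rmult_lt_0_compat; apply pow_lt; assumption.
Qed.

Lemma conv_bound f g A B b i j n : 0 <= A -> 0 <= B -> 0 < b ->
  (forall p, (p <= n)%nat -> Cmod (f p) <= A * (b ^ p * gw i p)) ->
  (forall p, (p <= n)%nat -> Cmod (g p) <= B * (b ^ p * gw j p)) ->
  Cmod (conv f g n) <= 4 * A * B * (b ^ n * gw (i + j) n).
Proof.
  intros hA hB hb hf hg.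
  apply Rle_trans with (sum_f_R0 (fun p => (gw i p * gw j (n - p)) * (A * B * b ^ n)) n).
  - apply Cmod_csum_le. intros p hp. rewrite Cmod_mult.
    apply Rle_trans with ((A * (b ^ p * gw i p)) * (B * (b ^ (n - p) * gw j (n - p)))).
    + apply Rmult_le_compat; try apply Cmod_ge_0; [apply hf|apply hg]; lia.
    + right. replace (b ^ n) with (b ^ p * b ^ (n - p)); [ring|].
      rewrite <- pow_add. f_equal. lia.
  - rewrite <- scal_sum.
    assert (hc : 0 <= A * B * b ^ n).
    { apply Rmult_le_pos; [apply Rmult_le_pos; assumption|apply pow_le; lra]. }
    pose proof (Rmult_le_compat_l _ _ _ hc (gw_conv i j n)). lra.
Qed.

(** The sum over the space index has [k + 1] terms; the one over the time index is
    absorbed by the weight. *)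
Lemma conv2_bound u v A B a b k n : 0 <= A -> 0 <= B -> 0 < a -> 0 < b ->
  (forall i p, (i <= k)%nat -> (p <= n)%nat -> Cmod (u i p) <= A * (a ^ i * b ^ p * gw i p)) ->
  (forall i p, (i <= k)%nat -> (p <= n)%nat -> Cmod (v i p) <= B * (a ^ i * b ^ p * gw i p)) ->
  Cmod (conv2 u v k n) <= 4 * A * B * INR (S k) * (a ^ k * b ^ n * gw k n).
Proof.
  intros hA hB ha hb hu hv. unfold conv2.
  set (K := 4 * A * B * (a ^ k * b ^ n * gw k n)).
  replace (4 * A * B * INR (S k) * (a ^ k * b ^ n * gw k n)) with (K * INR (S k))
    by (unfold K; ring).
  rewrite <- sum_cte. apply Cmod_csum_le. intros i hi.
  eapply Rle_trans; [apply (conv_bound _ _ (A * a ^ i) (B * a ^ (k - i)) b i (k - i))|].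
  - apply Rmult_le_pos; [exact hA|apply pow_le; lra].
  - apply Rmult_le_pos; [exact hB|apply pow_le; lra].
  - exact hb.
  - intros p hp. eapply Rle_trans; [apply hu; assumption|]. right. ring.
  - intros p hp. eapply Rle_trans; [apply hv; [lia|assumption]|]. right. ring.
  - right. unfold K. replace (i + (k - i))%nat with k by lia.
    replace (a ^ k) with (a ^ i * a ^ (k - i)); [ring|].
    rewrite <- pow_add. f_equal. lia.
Qed.

Lemma cubic_bound u M a b k n : 0 <= M -> 0 < a -> 0 < b ->
  (forall i p, (i <= k)%nat -> (p <= n)%nat -> Cmod (u i p) <= M * (a ^ i * b ^ p * gw i p)) ->
  Cmod (cubic u k n) <= 16 * M ^ 3 * INR (S k) ^ 2 * (a ^ k * b ^ n * gw k n).
Proof.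
  intros hM ha hb hu. unfold cubic.
  replace (16 * M ^ 3 * INR (S k) ^ 2 * (a ^ k * b ^ n * gw k n)) with
    (4 * (4 * M * M * INR (S k)) * M * INR (S k) * (a ^ k * b ^ n * gw k n)) by ring.
  apply conv2_bound; try assumption.
  - pose proof (pos_INR (S k)). assert (0 <= M * M) by nra.
    replace (4 * M * M * INR (S k)) with (4 * (M * M) * INR (S k)) by ring. nra.
  - intros i p hi hp.
    eapply Rle_trans; [apply (conv2_bound u u M M a b i p hM hM ha hb);
      intros; apply hu; lia|].
    apply Rmult_le_compat_r.
    + apply Rlt_le, weight_pos; assumption.
    + apply Rmult_le_compat_l; [nra|]. apply le_INR. lia.
  - intros i p hi hp. rewrite Cmod_conj. apply hu; assumption.
Qed.

Lemma Cmod_cis th : Cmod (cis th) = 1.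
Proof.
  unfold Cmod, cis. simpl fst. simpl snd.
  replace (cos th ^ 2 + sin th ^ 2) with 1; [apply sqrt_1|].
  pose proof (sin2_cos2 th) as h. unfold Rsqr in h. lra.
Qed.

Lemma cis_opp_mult th : (cis (- th) * cis th = RtoC 1)%C.
Proof.
  unfold cis, Cmult, RtoC. simpl. rewrite cos_neg, sin_neg.
  pose proof (sin2_cos2 th) as h. unfold Rsqr in h. f_equal; lra.
Qed.

Lemma solves_space th ph u k n : solves th ph u ->
  u (S (S k)) n = (RtoC (/ (INR (S k) * INR (S (S k)))) * cis (- th)
    * (RtoC (INR (S n)) * u k (S n) - cis ph * cubic u k n))%C.
Proof.
  intros h. rewrite (h k n).
  set (c := INR (S k) * INR (S (S k))).
  assert (hc : c <> 0) by (apply Rmult_integral_contrapositive; split; apply not_0_INR; lia).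
  replace (RtoC (/ c) * cis (- th) *
    (cis th * (RtoC c * u (S (S k)) n) + cis ph * cubic u k n - cis ph * cubic u k n))%C
    with ((RtoC (/ c) * RtoC c) * (cis (- th) * cis th) * u (S (S k)) n)%C by ring.
  rewrite cis_opp_mult, <- RtoC_mult, Rinv_l by exact hc. ring.
Qed.

Lemma gw_shift_time k n :
  INR (S n) * gw k (S n) = INR (S k) * INR (S (S k)) * gw (S (S k)) n.
Proof.
  unfold gw. replace (S (S k) + 2 * n)%nat with (k + 2 * S n)%nat by lia.
  rewrite !fct_S, !S_INR. pose proof (pos_INR n). pose proof (pos_INR k).
  pose proof (fct_pos n). pose proof (fct_pos k). field. repeat split; lra.
Qed.

Lemma gw_shift_space k n :
  INR (S k) ^ 2 * gw k n <= INR (S k) * INR (S (S k)) * gw (S (S k)) n.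
Proof.
  unfold gw. replace (S (S k) + 2 * n)%nat with (S (S (k + 2 * n))) by lia.
  rewrite !fct_S.
  replace (INR (S k) * INR (S (S k)) * ((INR (S (k + 2 * n)) + 1)
      * ((INR (k + 2 * n) + 1) * fct (k + 2 * n)) /
      ((INR (S k) + 1) * ((INR k + 1) * fct k) * fct n)))
    with ((INR (S (k + 2 * n)) + 1) * (INR (k + 2 * n) + 1)
      * (fct (k + 2 * n) / (fct k * fct n))).
  - apply Rmult_le_compat_r; [apply Rlt_le, (gw_pos k n)|].
    rewrite !S_INR, !plus_INR. pose proof (pos_INR (2 * n)). pose proof (pos_INR k). nra.
  - rewrite !S_INR. pose proof (pos_INR k). pose proof (fct_pos k). pose proof (fct_pos n).
    field. repeat split; lra.
Qed.

(** Marching in time from analytic data. The linear term turns the rates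
    [(a, b)] into a factor [a ^ 2 / b < 1]; the margin absorbs the cubic term when
    the data are small, since the weight has gained two orders. *)
Lemma solves_time_bound th ph u M a b : solves th ph u -> 0 <= M -> 0 < a -> 0 < b ->
  a ^ 2 + 16 * M ^ 2 <= b ->
  (forall k, Cmod (u k O) <= M * a ^ k) ->
  forall n k, Cmod (u k n) <= M * (a ^ k * b ^ n * gw k n).
Proof.
  intros hs hM ha hb hab h0.
  enough (H : forall n p, (p <= n)%nat -> forall k,
    Cmod (u k p) <= M * (a ^ k * b ^ p * gw k p)) by (intros n; apply (H n n); lia).
  induction n as [|n IH]; intros p hp k.
  - replace p with O by lia. rewrite gw_0r. simpl pow at 2. rewrite !Rmult_1_r. apply h0.
  - destruct (Nat.eq_dec p (S n)) as [->|ne]; [|apply IH; lia].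
    assert (hn : 0 < INR (S n)) by (apply lt_0_INR; lia).
    apply Rmult_le_reg_l with (INR (S n)); [exact hn|].
    rewrite <- (Rabs_pos_eq (INR (S n))) at 1 by lra.
    rewrite <- Cmod_R, <- Cmod_mult, (hs k n).
    eapply Rle_trans; [apply Cmod_triangle|].
    rewrite !Cmod_mult, !Cmod_cis, !Rmult_1_l, Cmod_R.
    set (c := INR (S k) * INR (S (S k))).
    assert (hc : 0 <= c) by (apply Rmult_le_pos; apply pos_INR).
    rewrite Rabs_pos_eq by exact hc.
    pose proof (IH n (le_n n) (S (S k))) as h2.
    apply (Rmult_le_compat_l _ _ _ hc) in h2.
    pose proof (cubic_bound u M a b k n hM ha hb) as h3.
    specialize (h3 ltac:(intros; apply IH; lia)).
    replace (INR (S n) * (M * (a ^ k * b ^ S n * gw k (S n)))) with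
      (M * (a ^ k * b ^ S n) * (INR (S n) * gw k (S n))) by ring.
    rewrite gw_shift_time. fold c.
    pose proof (gw_shift_space k n) as h4. fold c in h4.
    assert (hab' : 0 <= a ^ k * b ^ n) by (apply Rlt_le, Rmult_lt_0_compat; apply pow_lt; assumption).
    assert (hM3 : 0 <= 16 * M ^ 3 * (a ^ k * b ^ n)).
    { apply Rmult_le_pos; [|exact hab']. apply Rmult_le_pos; [lra|apply pow_le, hM]. }
    apply (Rmult_le_compat_l _ _ _ hM3) in h4.
    assert (hX : 0 <= c * gw (S (S k)) n) by (apply Rmult_le_pos; [exact hc|apply Rlt_le, gw_pos]).
    assert (h5 : M * (a ^ k * b ^ n) * (c * gw (S (S k)) n) * (a ^ 2 + 16 * M ^ 2)
      <= M * (a ^ k * b ^ n) * (c * gw (S (S k)) n) * b).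
    { apply Rmult_le_compat_l; [|exact hab].
      apply Rmult_le_pos; [apply Rmult_le_pos; assumption|exact hX]. }
    simpl pow in *. lra.
Qed.

(** Marching in space from Gevrey data at the end point. The roles of the two
    rates are exchanged. *)
Lemma solves_space_bound th ph u M a b : solves th ph u -> 0 <= M -> 0 < a -> 0 < b ->
  b + 16 * M ^ 2 <= a ^ 2 ->
  (forall n, u O n = RtoC 0) ->
  (forall n, Cmod (u 1%nat n) <= M * (a * b ^ n * gw 1 n)) ->
  forall k n, Cmod (u k n) <= M * (a ^ k * b ^ n * gw k n).
Proof.
  intros hs hM ha hb hab h0 h1.
  enough (H : forall k i, (i <= S k)%nat -> forall n,
    Cmod (u i n) <= M * (a ^ i * b ^ n * gw i n)) by (intros k; apply (H k k); lia).
  assert (hpos : forall i n, 0 <= a ^ i * b ^ n * gw i n).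
  { intros i n. apply Rlt_le, weight_pos; assumption. }
  induction k as [|k IH]; intros i hi n.
  - assert (i = O \/ i = 1%nat) as [->| ->] by lia.
    + rewrite h0, Cmod_0. apply Rmult_le_pos; [exact hM|apply hpos].
    + rewrite pow_1. apply h1.
  - destruct (Nat.eq_dec i (S (S k))) as [->|ne]; [|apply IH; lia].
    rewrite (solves_space th ph u k n hs).
    set (c := INR (S k) * INR (S (S k))).
    assert (hc : 0 < c) by (apply Rmult_lt_0_compat; apply lt_0_INR; lia).
    rewrite !Cmod_mult, Cmod_cis, Rmult_1_r, Cmod_R.
    rewrite Rabs_pos_eq by (apply Rlt_le, Rinv_0_lt_compat, hc).
    apply Rmult_le_reg_l with c; [exact hc|].
    rewrite <- Rmult_assoc, Rinv_r, Rmult_1_l by lra.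
    unfold Cminus. eapply Rle_trans; [apply Cmod_triangle|].
    rewrite Cmod_opp, !Cmod_mult, Cmod_cis, Rmult_1_l, Cmod_R, Rabs_pos_eq by apply pos_INR.
    pose proof (IH k ltac:(lia) (S n)) as h2.
    apply (Rmult_le_compat_l (INR (S n)) _ _ (pos_INR _)) in h2.
    replace (INR (S n) * (M * (a ^ k * b ^ S n * gw k (S n)))) with
      (M * (a ^ k * b ^ S n) * (INR (S n) * gw k (S n))) in h2 by ring.
    rewrite gw_shift_time in h2. fold c in h2.
    pose proof (cubic_bound u M a b k n hM ha hb) as h3.
    specialize (h3 ltac:(intros; apply IH; lia)).
    pose proof (gw_shift_space k n) as h4. fold c in h4.
    assert (hab' : 0 <= a ^ k * b ^ n) by (apply Rlt_le, Rmult_lt_0_compat; apply pow_lt; assumption).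
    assert (hM3 : 0 <= 16 * M ^ 3 * (a ^ k * b ^ n)).
    { apply Rmult_le_pos; [|exact hab']. apply Rmult_le_pos; [lra|apply pow_le, hM]. }
    apply (Rmult_le_compat_l _ _ _ hM3) in h4.
    assert (hX : 0 <= c * gw (S (S k)) n) by (apply Rmult_le_pos; [lra|apply Rlt_le, gw_pos]).
    assert (h5 : M * (a ^ k * b ^ n) * (c * gw (S (S k)) n) * (b + 16 * M ^ 2)
      <= M * (a ^ k * b ^ n) * (c * gw (S (S k)) n) * a ^ 2).
    { apply Rmult_le_compat_l; [|exact hab].
      apply Rmult_le_pos; [apply Rmult_le_pos; assumption|exact hX]. }
    simpl pow in *. lra.
Qed.

(** This replaces a uniqueness theorem for the evolution equation: the solution
    built from its traces at the end point takes the prescribed initial and final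
    states because both satisfy the same recursion in space. *)
Lemma solves_unique th ph u v : solves th ph u -> solves th ph v ->
  (forall n, u O n = v O n) -> (forall n, u 1%nat n = v 1%nat n) ->
  forall k n, u k n = v k n.
Proof.
  intros hu hv h0 h1.
  enough (H : forall k i, (i <= S k)%nat -> forall n, u i n = v i n)
    by (intros k; apply (H k k); lia).
  induction k as [|k IH]; intros i hi n.
  - assert (i = O \/ i = 1%nat) as [->| ->] by lia; [apply h0|apply h1].
  - destruct (Nat.eq_dec i (S (S k))) as [->|ne]; [|apply IH; lia].
    rewrite (solves_space th ph u k n hu), (solves_space th ph v k n hv).
    rewrite (cubic_ext u v k n), (IH k) by (intros; try apply IH; lia). reflexivity.
Qed.

Lemma conv2_parity u v b c k n :
  (forall i p, (p <= n)%nat -> Nat.odd i = b -> u i p = RtoC 0) ->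
  (forall i p, (p <= n)%nat -> Nat.odd i = c -> v i p = RtoC 0) ->
  Nat.odd k = negb (xorb b c) -> conv2 u v k n = RtoC 0.
Proof.
  intros hu hv hk. apply csum_0. intros i hi. apply csum_0. intros p hp.
  destruct (Bool.bool_dec (Nat.odd i) b) as [hi'|hi'].
  - rewrite hu by assumption. ring.
  - rewrite hv; [ring|lia|].
    rewrite Nat.odd_sub, hk by exact hi.
    destruct (Nat.odd i), b, c; simpl in *; congruence.
Qed.

(** Odd data launch an odd solution, because the nonlinearity is odd. *)
Lemma solves_odd th ph u : solves th ph u ->
  (forall k, Nat.odd k = false -> u k O = RtoC 0) ->
  forall n k, Nat.odd k = false -> u k n = RtoC 0.
Proof.
  intros hs h0.
  enough (H : forall n p, (p <= n)%nat -> forall k, Nat.odd k = false -> u k p = RtoC 0)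
    by (intros n; apply (H n n); lia).
  induction n as [|n IH]; intros p hp k hk.
  - replace p with O by lia. apply h0, hk.
  - destruct (Nat.eq_dec p (S n)) as [->|ne]; [|apply IH; [lia|exact hk]].
    assert (hcub : cubic u k n = RtoC 0).
    { apply (conv2_parity _ _ true false).
      - intros i q hq hi. apply (conv2_parity u u false false); try assumption;
          intros; apply IH; [lia|assumption|lia|assumption].
      - intros i q hq hi. rewrite IH by (lia || assumption).
        unfold Cconj, RtoC. simpl. f_equal. ring.
      - exact hk. }
    pose proof (hs k n) as e.
    rewrite hcub, (IH n (le_n n) (S (S k))) in e by exact hk.
    assert (hn : RtoC (INR (S n)) <> RtoC 0).
    { apply RtoC_neq_0, not_0_INR. lia. }
    replace (u k (S n)) with (/ RtoC (INR (S n)) * (RtoC (INR (S n)) * u k (S n)))%C.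
    + rewrite e. ring.
    + field. exact hn.
Qed.

(** Row [k] of a solution depends on all rows before it; [table Phi m] carries the
    first [m] of them through a structural recursion. *)
Fixpoint table (Phi : nat -> (nat -> nat -> C) -> nat -> C) (m : nat) : nat -> nat -> C :=
  match m with
  | O => fun _ _ => RtoC 0
  | S m => fun k => if Nat.eqb k m then Phi m (table Phi m) else table Phi m k
  end.

Definition rows (Phi : nat -> (nat -> nat -> C) -> nat -> C) (k : nat) : nat -> C :=
  table Phi (S k) k.

Lemma rows_eq Phi :
  (forall k f g, (forall j n, (j < k)%nat -> f j n = g j n) ->
     forall n, Phi k f n = Phi k g n) ->
  forall k n, rows Phi k n = Phi k (rows Phi) n.
Proof.
  intros hPhi.
  assert (htab : forall m j n, (j < m)%nat -> table Phi m j n = rows Phi j n).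
  { induction m as [|m IH]; intros j n hj; [lia|].
    unfold rows. simpl. rewrite Nat.eqb_refl.
    destruct (Nat.eqb_spec j m) as [->|ne]; [reflexivity|].
    rewrite IH by lia. unfold rows. simpl. rewrite Nat.eqb_refl. reflexivity. }
  intros k n. unfold rows at 1. simpl. rewrite Nat.eqb_refl.
  apply hPhi. intros j m hj. apply htab, hj.
Qed.

Lemma solves_time_exists th ph (alpha : nat -> C) :
  exists u, solves th ph u /\ forall k, u k O = alpha k.
Proof.
  set (Phi := fun n (f : nat -> nat -> C) k =>
    match n with
    | O => alpha k
    | S m => (/ RtoC (INR (S m)) * (cis th * (RtoC (INR (S k) * INR (S (S k))) * f m (S (S k)))
               + cis ph * cubic (fun i p => f p i) k m))%C
    end).
  assert (h : forall k n, rows Phi k n = Phi k (rows Phi) n).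
  { apply rows_eq. intros [|m] f g hfg k; [reflexivity|]. simpl.
    rewrite hfg by lia. rewrite (cubic_ext _ (fun i p => g p i)); [reflexivity|].
    intros i p _ hp. apply hfg. lia. }
  exists (fun k n => rows Phi n k). split.
  - intros k n. cbv beta. rewrite (h (S n)). unfold Phi at 1. cbv beta iota.
    field. apply RtoC_neq_0, not_0_INR. lia.
  - intros k. apply (h O).
Qed.

(** The formal solution of the Cauchy problem in space, with vanishing trace and
    normal derivative [gamma]. It is a function of [gamma], rather than merely known
    to exist, because [gamma] will depend on time. *)
Definition space_solution (th ph : R) (gamma : nat -> C) : nat -> nat -> C :=
  rows (fun k f n =>
    match k with
    | O => RtoC 0
    | S O => gamma n
    | S (S m) => (/ RtoC (INR (S m) * INR (S (S m))) * cis (- th)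
                  * (RtoC (INR (S n)) * f m (S n) - cis ph * cubic f m n))%C
    end).

Lemma space_solution_eq th ph gamma :
  (forall n, space_solution th ph gamma O n = RtoC 0) /\
  (forall n, space_solution th ph gamma 1%nat n = gamma n) /\
  solves th ph (space_solution th ph gamma).
Proof.
  unfold space_solution.
  match goal with |- context [rows ?P] => set (Phi := P) end.
  assert (h : forall k n, rows Phi k n = Phi k (rows Phi) n).
  { apply rows_eq. intros [|[|m]] f g hfg n; [reflexivity|reflexivity|]. simpl.
    rewrite hfg by lia. rewrite (cubic_ext f g); [reflexivity|].
    intros i p hi _. apply hfg. lia. }
  split; [|split].
  - intros n. apply (h O).
  - intros n. apply (h 1%nat).
  - intros k n. rewrite (h (S (S k))). unfold Phi at 2. cbv beta iota.
    set (c := INR (S k) * INR (S (S k))).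
    assert (hc : RtoC c <> RtoC 0).
    { apply RtoC_neq_0, Rmult_integral_contrapositive; split; apply not_0_INR; lia. }
    replace (cis th * (RtoC c * (/ RtoC c * cis (- th) *
      (RtoC (INR (S n)) * rows Phi k (S n) - cis ph * cubic (rows Phi) k n))))%C
      with ((cis (- th) * cis th) *
      (RtoC (INR (S n)) * rows Phi k (S n) - cis ph * cubic (rows Phi) k n))%C
      by (field; exact hc).
    rewrite cis_opp_mult. ring.
Qed.

Lemma njet_conv2 a b (U V : nat -> nat -> R -> C) k :
  (forall i, (i <= k)%nat -> njet a b (U i)) ->
  (forall i, (i <= k)%nat -> njet a b (V i)) ->
  njet a b (fun n t => conv2 (fun i p => U i p t) (fun i p => V i p t) k n).
Proof.
  intros hU hV.
  apply (njet_csum a b (fun i n t => conv (fun p => U i p t) (fun p => V (k - i)%nat p t) n)).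
  intros i hi. apply njet_conv; [apply hU|apply hV]; lia.
Qed.

Lemma njet_cubic a b (U : nat -> nat -> R -> C) k :
  (forall i, (i <= k)%nat -> njet a b (U i)) ->
  njet a b (fun n t => cubic (fun i p => U i p t) k n).
Proof.
  intros hU.
  apply (njet_conv2 a b (fun i n t => conv2 (fun i p => U i p t) (fun i p => U i p t) i n)
    (fun i n t => Cconj (U i n t))).
  - intros i hi. apply njet_conv2; intros; apply hU; lia.
  - intros i hi. apply njet_conj, hU, hi.
Qed.

(** If each time slice solves the equation, with jets as first two rows, then all
    rows are jets: the second index is truly the order of differentiation. *)
Lemma solves_njet th ph a b (U : nat -> nat -> R -> C) :
  (forall t, solves th ph (fun k n => U k n t)) ->
  njet a b (U O) -> njet a b (U 1%nat) -> forall k, njet a b (U k).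
Proof.
  intros hs h0 h1.
  enough (H : forall k i, (i <= S k)%nat -> njet a b (U i))
    by (intros k; apply (H k k); lia).
  induction k as [|k IH]; intros i hi.
  - assert (i = O \/ i = 1%nat) as [->| ->] by lia; assumption.
  - destruct (Nat.eq_dec i (S (S k))) as [->|ne]; [|apply IH; lia].
    intros n.
    set (c := (RtoC (/ (INR (S k) * INR (S (S k)))) * cis (- th))%C).
    pose proof (IH k ltac:(lia) (S n)) as hk.
    pose proof (njet_cubic a b U k ltac:(intros; apply IH; lia) n) as hc.
    pose proof (qder_scal a b c _ _ (qder_minus a b _ _ _ _
      (qder_scal a b (RtoC (INR (S n))) _ _ hk)
      (qder_scal a b (cis ph) _ _ hc))) as h.
    eapply qder_ext; [| |exact h]; intros t _; cbv beta.
    + symmetry. exact (solves_space th ph _ k n (hs t)).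
    + rewrite (solves_space th ph _ k (S n) (hs t)). fold c. ring.
Qed.

(** * Flat functions *)

Lemma pow_div_fct_le_exp u n : 0 <= u -> u ^ n / fct n <= exp u.
Proof.
  intros hu. eapply Rle_trans; [|apply (exp_ge_taylor u n hu)].
  assert (hpos : forall k, 0 <= u ^ k / fct k).
  { intros k. apply Rdiv_le_0_compat; [apply pow_le, hu|apply fct_pos]. }
  destruct n as [|n]; [apply Rle_refl|cbn [sum_f_R0]].
  assert (0 <= sum_f_R0 (fun k => u ^ k / fct k) n)
    by (apply cond_pos_sum; exact hpos). lra.
Qed.

(** The functions [t ^ (- j) * exp (- s / t)], extended by zero: up to constants the
    heat kernel in dimension [2 * j] at a fixed point other than the origin. *)
Definition flat (s : R) (j : nat) (t : R) : R :=
  if Rle_dec t 0 then 0 else exp (- s / t) / t ^ j.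

Lemma flat_0 s j t : t <= 0 -> flat s j t = 0.
Proof. intros h. unfold flat. destruct (Rle_dec t 0); [reflexivity|lra]. Qed.

Lemma flat_pos_eq s j t : 0 < t -> flat s j t = exp (- s / t) / t ^ j.
Proof. intros h. unfold flat. destruct (Rle_dec t 0); [lra|reflexivity]. Qed.

Lemma flat_ge0 s j t : 0 <= flat s j t.
Proof.
  destruct (Rle_dec t 0) as [h|h]; [rewrite flat_0 by exact h; lra|].
  rewrite flat_pos_eq by lra.
  apply Rdiv_le_0_compat; [apply Rlt_le, exp_pos|apply pow_lt; lra].
Qed.

Lemma flat_le s j t : 0 < s -> flat s j t <= fct j / s ^ j.
Proof.
  intros hs. pose proof (pow_lt s j hs) as hsj. pose proof (fct_pos j) as hj.
  destruct (Rle_dec t 0) as [h|h].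
  { rewrite flat_0 by exact h. apply Rdiv_le_0_compat; lra. }
  rewrite flat_pos_eq by lra.
  assert (hst : 0 < s / t) by (apply Rdiv_lt_0_compat; lra).
  pose proof (pow_div_fct_le_exp (s / t) j ltac:(lra)) as he.
  replace (- s / t) with (- (s / t)) by (field; lra). rewrite exp_Ropp.
  pose proof (exp_pos (s / t)) as hE. set (E := exp (s / t)) in *.
  assert (htj : 0 < t ^ j) by (apply pow_lt; lra).
  unfold Rdiv in he. rewrite Rpow_mult_distr, pow_inv in he.
  apply Rmult_le_reg_l with (E * s ^ j * / fct j).
  { apply Rmult_lt_0_compat; [nra|apply Rinv_0_lt_compat, hj]. }
  replace (E * s ^ j * / fct j * (/ E / t ^ j)) with (s ^ j * / t ^ j * / fct j)
    by (field; repeat split; lra).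
  replace (E * s ^ j * / fct j * (fct j / s ^ j)) with E by (field; split; lra).
  exact he.
Qed.

Lemma flat_mult s j t : t * flat s (S j) t = flat s j t.
Proof.
  destruct (Rle_dec t 0) as [h|h]; [rewrite !flat_0 by exact h; ring|].
  rewrite !flat_pos_eq by lra. simpl. field. split; [|lra]. apply pow_nonzero. lra.
Qed.

Definition flat' (s : R) (j : nat) (t : R) : R :=
  s * flat s (S (S j)) t - INR j * flat s (S j) t.

Lemma flat_derive s j t : 0 < t -> is_derive (flat s j) t (flat' s j t).
Proof.
  intros ht. unfold flat'. rewrite !flat_pos_eq by exact ht.
  apply (is_derive_ext_loc (fun t => exp (- s / t) / t ^ j)).
  { exists (mkposreal t ht). intros y hy. change (Rabs (y - t) < t) in hy.
    apply Rabs_def2 in hy. symmetry. apply flat_pos_eq. lra. }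
  assert (htj : t ^ j <> 0) by (apply pow_nonzero; lra).
  auto_derive; [repeat split; lra|].
  change (- s * / t) with (- s / t). set (E := exp (- s / t)).
  destruct j as [|j]; [simpl; field; lra|].
  assert (t ^ j <> 0) by (apply pow_nonzero; lra).
  cbn [Init.Nat.pred]. set (c := INR (S j)). simpl pow. field. split; lra.
Qed.

Lemma mean_value_pos (f f' : R -> R) x y : (forall t, 0 < t -> is_derive f t (f' t)) ->
  0 < x -> 0 < y -> exists c, 0 < c /\ Rabs (c - x) <= Rabs (y - x) /\
    f y - f x = f' c * (y - x).
Proof.
  intros hf hx hy.
  assert (hmin : 0 < Rmin x y) by (apply Rmin_pos; assumption).
  destruct (MVT_gen f x y f') as [c [hc e]].
  - intros z hz. apply hf. lra.
  - intros z hz. apply continuity_pt_filterlim.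
    apply (ex_derive_continuous (V := R_NormedModule)). exists (f' z). apply hf. lra.
  - exists c. split; [lra|]. split; [|exact e].
    unfold Rmin, Rmax in hc. destruct (Rle_dec x y).
    + rewrite !Rabs_pos_eq; lra.
    + rewrite !Rabs_left1; lra.
Qed.

Lemma flat_qder s j T : 0 < s ->
  qder 0 T (fun t => RtoC (flat s j t)) (fun t => RtoC (flat' s j t)).
Proof.
  intros hs. set (B := fun i => fct i / s ^ i).
  assert (hB : forall i t, 0 <= flat s i t <= B i).
  { intros i t. split; [apply flat_ge0|apply flat_le, hs]. }
  assert (hB0 : forall i, 0 <= B i) by (intros i; destruct (hB i 0); lra).
  set (j1 := INR j). assert (hj : 0 <= j1) by apply pos_INR.
  set (D := s * (s * B (4 + j)%nat + (j1 + 2) * B (3 + j)%nat)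
    + j1 * (s * B (3 + j)%nat + (j1 + 1) * B (2 + j)%nat)).
  set (E := B (2 + j)%nat + (s * B (3 + j)%nat + j1 * B (2 + j)%nat)).
  assert (hD : 0 <= D).
  { unfold D. apply Rplus_le_le_0_compat; apply Rmult_le_pos; try lra;
      apply Rplus_le_le_0_compat; apply Rmult_le_pos; try apply hB0; lra. }
  assert (hE : 0 <= E).
  { unfold E. apply Rplus_le_le_0_compat; [apply hB0|].
    apply Rplus_le_le_0_compat; apply Rmult_le_pos; try apply hB0; lra. }
  assert (hsq : forall t, flat s j t = t ^ 2 * flat s (2 + j) t).
  { intros t. simpl. rewrite <- (flat_mult s j), <- (flat_mult s (S j)). ring. }
  assert (hsq' : forall t, t * flat' s j t = t ^ 2 * (s * flat s (3 + j) t - j1 * flat s (2 + j) t)).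
  { intros t. unfold flat'. simpl. fold j1.
    rewrite <- (flat_mult s (S j) t), <- (flat_mult s (S (S j)) t). ring. }
  exists (D + E). intros x y [hx0 hxT] [hy0 hyT].
  rewrite <- RtoC_minus, <- RtoC_mult, <- RtoC_minus, Cmod_R.
  pose proof (pow2_ge_0 (y - x)) as hq.
  destruct (Req_dec x 0) as [->|hx].
  { rewrite (flat_0 s j 0) by lra. unfold flat'. rewrite !(flat_0 _ _ 0) by lra.
    replace (flat s j y - 0 - (y - 0) * (s * 0 - INR j * 0)) with (flat s j y) by ring.
    rewrite Rabs_pos_eq by apply flat_ge0. rewrite hsq.
    replace (y - 0) with y in * by ring.
    destruct (hB (2 + j)%nat y) as [_ h]. apply (Rmult_le_compat_l _ _ _ hq) in h.
    assert (B (2 + j)%nat <= D + E).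
    { unfold E. pose proof (hB0 (2 + j)%nat). pose proof (hB0 (3 + j)%nat). nra. }
    nra. }
  destruct (Req_dec y 0) as [->|hy].
  { rewrite (flat_0 s j 0) by lra.
    replace (0 - flat s j x - (0 - x) * flat' s j x) with
      (- flat s j x + x * flat' s j x) by ring.
    rewrite hsq', hsq.
    replace (- (x ^ 2 * flat s (2 + j) x) + x ^ 2 * (s * flat s (3 + j) x - j1 * flat s (2 + j) x))
      with ((0 - x) ^ 2 * (s * flat s (3 + j) x - flat s (2 + j) x - j1 * flat s (2 + j) x))
      by ring.
    rewrite Rabs_mult, (Rabs_pos_eq ((0 - x) ^ 2)) by exact hq.
    rewrite (Rmult_comm (D + E)). apply Rmult_le_compat_l; [exact hq|].
    destruct (hB (2 + j)%nat x) as [h1 h2]. destruct (hB (3 + j)%nat x) as [h3 h4].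
    apply Rabs_le. unfold E.
    pose proof (Rmult_le_compat_l _ _ _ (Rlt_le _ _ hs) h4).
    pose proof (Rmult_le_compat_l _ _ _ hj h2).
    assert (0 <= s * flat s (3 + j) x) by nra.
    assert (0 <= j1 * flat s (2 + j) x) by nra. lra. }
  destruct (mean_value_pos _ _ x y (flat_derive s j)) as [c [hc [hcx e]]]; [lra|lra|].
  rewrite e.
  assert (hd2 : forall t, 0 < t -> is_derive (flat' s j) t
    (s * flat' s (S (S j)) t - INR j * flat' s (S j) t)).
  { intros t ht. apply (is_derive_minus (K := R_AbsRing) (V := R_NormedModule));
      apply is_derive_scal; apply flat_derive; exact ht. }
  destruct (mean_value_pos _ _ x c hd2) as [d [hd [_ e2]]]; [lra|lra|].
  replace (flat' s j c * (y - x) - (y - x) * flat' s j x) with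
    ((flat' s j c - flat' s j x) * (y - x)) by ring.
  rewrite e2, !Rabs_mult.
  set (d2 := s * flat' s (S (S j)) d - INR j * flat' s (S j) d).
  assert (hd2D : Rabs d2 <= D).
  { unfold d2, flat'. rewrite !S_INR. fold j1.
    destruct (hB (2 + j)%nat d) as [h1 h2]. destruct (hB (3 + j)%nat d) as [h3 h4].
    destruct (hB (4 + j)%nat d) as [h5 h6]. cbn [Nat.add] in *.
    set (f2 := flat s (S (S j)) d) in *. set (f3 := flat s (S (S (S j))) d) in *.
    set (f4 := flat s (S (S (S (S j)))) d) in *.
    assert (s * (s * f4) <= s * (s * B (4 + j)%nat)).
    { apply Rmult_le_compat_l; [lra|]. apply Rmult_le_compat_l; [lra|exact h6]. }
    assert (s * ((j1 + 2) * f3) <= s * ((j1 + 2) * B (3 + j)%nat)).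
    { apply Rmult_le_compat_l; [lra|]. apply Rmult_le_compat_l; [lra|exact h4]. }
    assert (j1 * (s * f3) <= j1 * (s * B (3 + j)%nat)).
    { apply Rmult_le_compat_l; [lra|]. apply Rmult_le_compat_l; [lra|exact h4]. }
    assert (j1 * ((j1 + 1) * f2) <= j1 * ((j1 + 1) * B (2 + j)%nat)).
    { apply Rmult_le_compat_l; [lra|]. apply Rmult_le_compat_l; [lra|exact h2]. }
    assert (0 <= s * (s * f4)) by (apply Rmult_le_pos; nra).
    assert (0 <= s * ((j1 + 2) * f3)) by (apply Rmult_le_pos; nra).
    assert (0 <= j1 * (s * f3)) by (apply Rmult_le_pos; nra).
    assert (0 <= j1 * ((j1 + 1) * f2)) by (apply Rmult_le_pos; nra).
    cbn [Nat.add] in *. unfold D. cbn [Nat.add]. apply Rabs_le. lra. }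
  rewrite <- (pow2_abs (y - x)).
  pose proof (Rabs_pos (y - x)). pose proof (Rabs_pos (c - x)). pose proof (Rabs_pos d2).
  apply Rle_trans with (D * Rabs (y - x) * Rabs (y - x)).
  - apply Rmult_le_compat_r; [lra|]. apply Rmult_le_compat; lra.
  - nra.
Qed.

(** Normalised derivatives of [flat s j]; those of all [j] are generated at once. *)
Fixpoint flatjet (s : R) (m j : nat) (t : R) : R :=
  match m with
  | O => flat s j t
  | S m' => (s * flatjet s m' (S (S j)) t - INR j * flatjet s m' (S j) t) / INR (S m')
  end.

Lemma flatjet_njet s j T : 0 < s -> njet 0 T (fun m t => RtoC (flatjet s m j t)).
Proof.
  intros hs m. revert j. induction m as [|m IH]; intros j.
  - eapply qder_ext; [| |exact (flat_qder s j T hs)]; intros t _; [reflexivity|].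
    unfold flat'. rewrite <- RtoC_mult. f_equal. simpl. field.
  - pose proof (qder_scal 0 T (RtoC (/ INR (S m))) _ _ (qder_minus 0 T _ _ _ _
      (qder_scal 0 T (RtoC s) _ _ (IH (S (S j))))
      (qder_scal 0 T (RtoC (INR j)) _ _ (IH (S j))))) as h.
    assert (hm : INR (S m) <> 0) by (apply not_0_INR; lia).
    eapply qder_ext; [| |exact h]; intros t _; cbv beta;
      rewrite <- ?RtoC_mult, <- ?RtoC_minus, <- ?RtoC_mult; f_equal.
    + cbn [flatjet]. field. exact hm.
    + change (flatjet s (S (S m)) j t) with
        ((s * flatjet s (S m) (S (S j)) t - INR j * flatjet s (S m) (S j) t) / INR (S (S m))).
      field. split; [apply not_0_INR; lia|exact hm].
Qed.

Lemma flatjet_0 s m j : flatjet s m j 0 = 0.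
Proof.
  revert j. induction m as [|m IH]; intros j; [apply flat_0; lra|].
  cbn [flatjet]. rewrite !IH. unfold Rdiv. ring.
Qed.

Lemma flatjet_bound s m j t : 0 < s ->
  Rabs (flatjet s m j t) <= (2 / s) ^ m * fct (2 * m + j) / (fct m * s ^ j).
Proof.
  intros hs. revert j. induction m as [|m IH]; intros j.
  - cbn [flatjet]. rewrite Rabs_pos_eq by apply flat_ge0.
    eapply Rle_trans; [apply flat_le, hs|]. simpl. right. field. apply pow_nonzero. lra.
  - cbn [flatjet].
    assert (hm : 0 < INR (S m)) by (apply lt_0_INR; lia).
    unfold Rdiv at 1. rewrite Rabs_mult, (Rabs_pos_eq (/ _))
      by (apply Rlt_le, Rinv_0_lt_compat, hm).
    apply Rmult_le_reg_r with (INR (S m)); [exact hm|].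
    rewrite Rmult_assoc, Rinv_l, Rmult_1_r by lra.
    unfold Rminus. eapply Rle_trans; [apply Rabs_triang|].
    rewrite Rabs_Ropp, !Rabs_mult, (Rabs_pos_eq s), (Rabs_pos_eq (INR j))
      by (lra || apply pos_INR).
    pose proof (Rmult_le_compat_l s _ _ (Rlt_le _ _ hs) (IH (S (S j)))) as h1.
    pose proof (Rmult_le_compat_l (INR j) _ _ (pos_INR j) (IH (S j))) as h2.
    replace (2 * m + S (S j))%nat with (S (2 * m + S j)) in h1 by lia.
    replace (2 * S m + j)%nat with (S (2 * m + S j)) by lia.
    set (N := (2 * m + S j)%nat) in *.
    assert (hN : INR j <= INR N + 1).
    { rewrite <- S_INR. apply le_INR. unfold N. lia. }
    pose proof (fct_pos m) as hfm. pose proof (fct_pos N) as hfN.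
    pose proof (pow_lt s j hs) as hsj.
    assert (hA : 0 < (2 / s) ^ m) by (apply pow_lt, Rdiv_lt_0_compat; lra).
    set (A := (2 / s) ^ m) in *.
    rewrite !fct_S, (S_INR m) in *. simpl pow in *. fold A.
    set (c := A * fct N / (fct m * s ^ j * s)).
    assert (hc : 0 < c).
    { unfold c. apply Rdiv_lt_0_compat; [apply Rmult_lt_0_compat; assumption|]. repeat apply Rmult_lt_0_compat; lra. }
    replace (s * (A * ((INR N + 1) * fct N) / (fct m * (s * (s * s ^ j))))) with
      (c * (INR N + 1)) in h1 by (unfold c; field; repeat split; lra).
    replace (INR j * (A * fct N / (fct m * (s * s ^ j)))) with (c * INR j) in h2
      by (unfold c; field; repeat split; lra).
    replace (2 / s * A * ((INR N + 1) * fct N) / ((INR m + 1) * fct m * s ^ j) * (INR m + 1))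
      with (2 * c * (INR N + 1)) by (unfold c; field; repeat split; lra).
    pose proof (Rmult_le_compat_l c _ _ (Rlt_le _ _ hc) hN) as h3. lra.
Qed.

(** * A Borel theorem with explicit rates *)

Lemma exp_sub_taylor_le u q : 0 <= u ->
  exp u - sum_f_R0 (fun k => u ^ k / fct k) q <= u ^ q / fct q * exp u.
Proof.
  intros hu. set (T := sum_f_R0 (fun k => u ^ k / fct k)).
  assert (hpos : forall k, 0 <= u ^ k / fct k).
  { intros k. apply Rdiv_le_0_compat; [apply pow_le, hu|apply fct_pos]. }
  assert (hT : forall m, T (q + m)%nat - T q <= u ^ q / fct q * T m).
  { induction m as [|m IH].
    - rewrite Nat.add_0_r. unfold T at 3. simpl. pose proof (hpos q).
      replace (u ^ q / fct q * (1 / 1)) with (u ^ q / fct q) by (field; apply INR_fact_neq_0). lra.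
    - rewrite Nat.add_succ_r. unfold T in *. cbn [sum_f_R0].
      replace (S (q + m)) with (q + S m)%nat by lia.
      assert (h : u ^ (q + S m) / fct (q + S m) <= u ^ q / fct q * (u ^ S m / fct (S m))).
      { pose proof (fct_pos q). pose proof (fct_pos (S m)). pose proof (fct_mul_le q (S m)).
        replace (u ^ q / fct q * (u ^ S m / fct (S m))) with
          (u ^ (q + S m) * / (fct q * fct (S m))) by (rewrite pow_add; field; lra).
        apply Rmult_le_compat_l; [apply pow_le, hu|].
        apply Rinv_le_contravar; [nra|assumption]. }
      lra. }
  assert (hle : forall m, T m <= exp u) by (intros m; apply exp_ge_taylor, hu).
  apply le_epsilon. intros eps heps.
  assert (hlim : infinite_sum (fun k => / fct k * u ^ k) (exp u)).
  { unfold exp. destruct (exist_exp u) as [l hl]. exact hl. }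
  destruct (hlim eps heps) as [N hN].
  specialize (hN (q + N)%nat ltac:(lia)). unfold Rdist in hN.
  replace (sum_f_R0 (fun k => / fct k * u ^ k) (q + N)) with (T (q + N)%nat) in hN.
  2:{ apply sum_eq. intros i _. unfold Rdiv. ring. }
  apply Rabs_def2 in hN. specialize (hT N).
  pose proof (Rmult_le_compat_l _ _ _ (hpos q) (hle N)). lra.
Qed.

(** For [t > 0] this is the integral over [sigma] from [0] to [s] of
    [sigma ^ q / q! * exp (- sigma / t) / t], or [t ^ q] times the probability that a
    Poisson variable of mean [s / t] exceeds [q]. It has the Taylor series of [t ^ q]
    at [0] but never exceeds [s ^ q / q!], so that series [sum delta_q * kap s q]
    converge for Gevrey data for which [sum delta_q * t ^ q] diverges. *)
Fixpoint kap (s : R) (q : nat) (t : R) : R :=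
  match q with
  | O => 1 - flat s 0 t
  | S q' => t * kap s q' t - s ^ S q' / fct (S q') * flat s 0 t
  end.

Lemma kap_pos_eq s q t : 0 < t -> kap s q t =
  t ^ q * (1 - exp (- (s / t)) * sum_f_R0 (fun k => (s / t) ^ k / fct k) q).
Proof.
  intros ht. assert (hf : flat s 0 t = exp (- (s / t))).
  { rewrite flat_pos_eq by exact ht. simpl. unfold Rdiv. rewrite Rinv_1, Rmult_1_r.
    f_equal. ring. }
  induction q as [|q IH].
  - simpl. rewrite hf. field.
  - cbn [kap sum_f_R0]. rewrite IH, hf. unfold Rdiv. rewrite !Rpow_mult_distr, !pow_inv.
    set (S0 := sum_f_R0 _ q). simpl pow. field.
    pose proof (INR_fact_neq_0 (S q)). repeat split; try lra; apply pow_nonzero; lra.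
Qed.

Lemma kap_bound s q t : 0 < s -> 0 <= t -> 0 <= kap s q t <= s ^ q / fct q.
Proof.
  intros hs ht. pose proof (fct_pos q) as hq. pose proof (pow_lt s q hs) as hsq.
  assert (h0 : 0 < s ^ q / fct q) by (apply Rdiv_lt_0_compat; lra).
  destruct (Req_dec t 0) as [->|hne].
  - destruct q as [|q]; cbn [kap]; rewrite flat_0 by lra; simpl in *; lra.
  - assert (ht' : 0 < t) by lra. rewrite kap_pos_eq by exact ht'.
    assert (hu : 0 <= s / t) by (apply Rdiv_le_0_compat; lra).
    pose proof (exp_ge_taylor (s / t) q hu) as h1.
    pose proof (exp_sub_taylor_le (s / t) q hu) as h2.
    rewrite exp_Ropp. pose proof (exp_pos (s / t)) as hE.
    set (E := exp (s / t)) in *.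
    set (S0 := sum_f_R0 _ q) in *.
    replace (1 - / E * S0) with ((E - S0) * / E) by (field; lra).
    pose proof (pow_lt t q ht') as htq.
    assert (hEi : 0 < / E) by (apply Rinv_0_lt_compat, hE).
    split.
    + apply Rmult_le_pos; [lra|]. apply Rmult_le_pos; lra.
    + apply Rle_trans with (t ^ q * ((s / t) ^ q / fct q * E * / E)).
      * apply Rmult_le_compat_l; [lra|]. apply Rmult_le_compat_r; lra.
      * right. unfold Rdiv. rewrite Rpow_mult_distr, pow_inv. field. repeat split; lra.
Qed.

Definition kap' (s : R) (q : nat) (t : R) : R :=
  INR q * kap s (pred q) t
    - s ^ q / fct q * (INR q * flat s 1 t + s * flat s 2 t).

Lemma kap_qder s q T : 0 < s ->
  qder 0 T (fun t => RtoC (kap s q t)) (fun t => RtoC (kap' s q t)).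
Proof.
  intros hs. pose proof (flat_qder s 0 T hs) as hf0.
  induction q as [|q IH].
  - eapply qder_ext; [| |exact (qder_minus _ _ _ _ _ _ (qder_const 0 T (RtoC 1)) hf0)];
      intros t _; cbv beta; rewrite <- RtoC_minus; f_equal.
    unfold kap', flat'. simpl. field.
  - set (c := s ^ S q / fct (S q)).
    eapply qder_ext; [| |exact (qder_minus _ _ _ _ _ _
      (qder_mult _ _ _ _ _ _ (qder_id 0 T) IH) (qder_scal _ _ (RtoC c) _ _ hf0))];
      intros t _; cbv beta; rewrite <- ?RtoC_mult, <- ?RtoC_plus, <- ?RtoC_minus; f_equal.
    unfold kap', flat'. cbn [pred].
    assert (h : t * kap s (pred q) t * INR q
      = INR q * (kap s q t + s ^ q / fct q * flat s 0 t)).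
    { destruct q as [|q]; [simpl; ring|]. cbn [kap pred]. ring. }
    assert (hfq : c = s * s ^ q / (fct q * (INR q + 1))).
    { unfold c. rewrite fct_S. simpl pow. f_equal. ring. }
    fold c. rewrite hfq, S_INR, <- (flat_mult s 0 t), <- (flat_mult s 1 t) in *.
    pose proof (INR_fact_neq_0 q). pose proof (pos_INR q).
    replace (1 * kap s q t + t * (INR q * kap s (pred q) t
        - s ^ q / fct q * (INR q * (t * flat s 2 t) + s * flat s 2 t)))
      with (kap s q t + t * kap s (pred q) t * INR q
        - t * s ^ q / fct q * (INR q * (t * flat s 2 t) + s * flat s 2 t)) by (field; lra).
    rewrite h. simpl INR. field. split; lra.
Qed.

Fixpoint kapjet (s : R) (n q : nat) (t : R) : R :=
  match n with
  | O => kap s q t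
  | S n' => (INR q * kapjet s n' (pred q) t
      - s ^ q / fct q * (INR q * flatjet s n' 1 t + s * flatjet s n' 2 t)) / INR (S n')
  end.

Lemma kapjet_njet s q T : 0 < s -> njet 0 T (fun n t => RtoC (kapjet s n q t)).
Proof.
  intros hs n. revert q. induction n as [|n IH]; intros q.
  - eapply qder_ext; [| |exact (kap_qder s q T hs)]; intros t _; [reflexivity|].
    rewrite <- RtoC_mult. f_equal. unfold kap'. simpl. field. apply INR_fact_neq_0.
  - pose proof (qder_scal 0 T (RtoC (/ INR (S n))) _ _ (qder_minus 0 T _ _ _ _
      (qder_scal 0 T (RtoC (INR q)) _ _ (IH (pred q)))
      (qder_scal 0 T (RtoC (s ^ q / fct q)) _ _ (qder_plus 0 T _ _ _ _
        (qder_scal 0 T (RtoC (INR q)) _ _ (flatjet_njet s 1 T hs n))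
        (qder_scal 0 T (RtoC s) _ _ (flatjet_njet s 2 T hs n)))))) as h.
    assert (hn : INR (S n) <> 0) by (apply not_0_INR; lia).
    assert (hn' : INR (S (S n)) <> 0) by (apply not_0_INR; lia).
    pose proof (INR_fact_neq_0 q) as hq.
    eapply qder_ext; [| |exact h]; intros t _; cbv beta;
      rewrite <- ?RtoC_mult, <- ?RtoC_plus, <- ?RtoC_mult, <- ?RtoC_minus, <- ?RtoC_mult;
      f_equal.
    + cbn [kapjet]. field. split; assumption.
    + change (kapjet s (S (S n)) q t) with ((INR q * kapjet s (S n) (pred q) t
        - s ^ q / fct q * (INR q * flatjet s (S n) 1 t + s * flatjet s (S n) 2 t))
        / INR (S (S n))).
      field. repeat split; assumption.
Qed.

Lemma kapjet_0 s n q : kapjet s n q 0 = if Nat.eqb q n then 1 else 0.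
Proof.
  revert q. induction n as [|n IH]; intros q.
  - destruct q as [|q]; cbn [kapjet kap Nat.eqb]; rewrite flat_0 by lra; ring.
  - cbn [kapjet]. rewrite IH, !flatjet_0.
    destruct q as [|q]; cbn [pred Nat.eqb].
    + simpl (INR 0). unfold Rdiv. ring.
    + destruct (Nat.eqb_spec q n) as [->|ne].
      * field. split; [apply INR_fact_neq_0|apply not_0_INR; lia].
      * unfold Rdiv. ring.
Qed.

(** The smallness of [kap s q] compensates the growth of the datum of index [q + j],
    leaving a geometric factor; the shift [j] stands for differentiations already
    made. The factors [16] and [4] are the powers of two lost when the factorial of
    [2 * (q + j) + 1] is split into [q!], [q!] and [(2 * j + 1)!]. *)
Lemma kap_weight s H q j : 0 < s -> 0 < H ->
  s ^ q / fct q * (H ^ (q + j) * fct (2 * (q + j) + 1) / fct q)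
    <= 2 * (16 * s * H) ^ q * (4 * H) ^ j * fct (2 * j + 1).
Proof.
  intros hs hH.
  pose proof (fct_split_le (2 * q) (2 * j + 1)) as h1.
  pose proof (fct_split_le q q) as h2.
  replace (2 * q + (2 * j + 1))%nat with (2 * (q + j) + 1)%nat in h1 by lia.
  replace (q + q)%nat with (2 * q)%nat in h2 by lia.
  pose proof (fct_pos q) as hq. pose proof (fct_pos (2 * j + 1)) as hj.
  assert (e1 : 2 ^ (2 * (q + j) + 1) = 2 * 4 ^ q * 4 ^ j).
  { rewrite pow_add, pow_mult, pow_add. simpl. replace (2 * (2 * 1)) with 4 by ring. ring. }
  assert (e2 : 2 ^ (2 * q) = 4 ^ q).
  { rewrite pow_mult. f_equal. simpl. ring. }
  rewrite e1 in h1. rewrite e2 in h2.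
  assert (h4q : 0 < 4 ^ q) by (apply pow_lt; lra).
  assert (h4j : 0 < 4 ^ j) by (apply pow_lt; lra).
  assert (h3 : fct (2 * (q + j) + 1)
    <= 2 * 4 ^ q * 4 ^ j * (4 ^ q * (fct q * fct q) * fct (2 * j + 1))).
  { eapply Rle_trans; [exact h1|]. apply Rmult_le_compat_l.
    - apply Rlt_le. repeat apply Rmult_lt_0_compat; lra.
    - apply Rmult_le_compat_r; lra. }
  replace (2 * (16 * s * H) ^ q * (4 * H) ^ j * fct (2 * j + 1)) with
    (s ^ q / fct q * (H ^ (q + j)
      * (2 * 4 ^ q * 4 ^ j * (4 ^ q * (fct q * fct q) * fct (2 * j + 1))) / fct q)).
  - apply Rmult_le_compat_l.
    + apply Rdiv_le_0_compat; [apply pow_le; lra|exact hq].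
    + apply Rmult_le_compat_r; [apply Rlt_le, Rinv_0_lt_compat, hq|].
      apply Rmult_le_compat_l; [apply pow_le; lra|exact h3].
  - replace (16 * s * H) with (4 * 4 * s * H) by ring.
    rewrite !Rpow_mult_distr, pow_add. field. lra.
Qed.

(** Differentiating [kap s q] lowers [q], at the cost of flat terms coming from the
    truncation at [s]. Lowering [q] against a fixed datum raises the shift [j], so
    that the induction on [n] closes for all [j] together. A differentiation costs
    [4 * H / theta], that is [2 / s] divided by [8], in the first term, and [2 / s] in
    the flat ones: the latter rate prevails. *)
Lemma kapjet_bound s H theta n q j t : 0 < s -> 0 < H -> theta = 16 * s * H -> 0 <= t ->
  Rabs (kapjet s n q t) * (H ^ (q + j) * fct (2 * (q + j) + 1) / fct q)
    <= 2 * (INR q + 1) * theta ^ q * (4 * H) ^ j * (2 / s) ^ n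
       * (fct (2 * (n + j) + 1) / fct n).
Proof.
  intros hs hH hth ht.
  assert (hth0 : 0 < theta) by (rewrite hth; apply Rmult_lt_0_compat; lra).
  assert (hw : forall q j, 0 < H ^ (q + j) * fct (2 * (q + j) + 1) / fct q).
  { intros q' j'. pose proof (pow_lt H (q' + j') hH). pose proof (fct_pos q').
    pose proof (fct_pos (2 * (q' + j') + 1)). apply Rdiv_lt_0_compat; nra. }
  revert q j. induction n as [|n IH]; intros q j.
  - cbn [kapjet]. destruct (kap_bound s q t hs ht) as [hk0 hk1].
    rewrite Rabs_pos_eq by exact hk0.
    eapply Rle_trans; [apply Rmult_le_compat_r; [apply Rlt_le, hw|exact hk1]|].
    eapply Rle_trans; [apply kap_weight; assumption|]. rewrite <- hth.
    simpl (fct 0). simpl pow at 4. simpl (0 + j)%nat.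
    pose proof (pow_lt theta q hth0) as h1. pose proof (pow_lt (4 * H) j ltac:(lra)) as h2.
    pose proof (fct_pos (2 * j + 1)) as h3. pose proof (pos_INR q).
    assert (0 < theta ^ q * (4 * H) ^ j * fct (2 * j + 1)).
    { apply Rmult_lt_0_compat; [apply Rmult_lt_0_compat|]; assumption. }
    replace (fct (2 * j + 1) / 1) with (fct (2 * j + 1)) by field. nra.
  - set (b := 2 / s). assert (hb : 0 < b) by (apply Rdiv_lt_0_compat; lra).
    set (F := fct (2 * (S n + j) + 1)). assert (hF : 0 < F) by apply fct_pos.
    set (w := H ^ (q + j) * fct (2 * (q + j) + 1) / fct q).
    assert (hw' : 0 < w) by apply hw.
    set (X := theta ^ q * (4 * H) ^ j * b ^ S n * (F / fct n)).
    assert (hthq : 0 < theta ^ q) by (apply pow_lt, hth0).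
    assert (h4Hj : 0 < (4 * H) ^ j) by (apply pow_lt; lra).
    assert (hbn : 0 < b ^ n) by (apply pow_lt, hb).
    pose proof (fct_pos n) as hn. pose proof (pos_INR q) as hq.
    assert (hX : 0 < X).
    { unfold X. apply Rmult_lt_0_compat; [|apply Rdiv_lt_0_compat; lra].
      apply Rmult_lt_0_compat; [apply Rmult_lt_0_compat|apply pow_lt]; lra. }
    (* the index is lowered: induction hypothesis with [j] raised *)
    assert (hA : Rabs (INR q * kapjet s n (pred q) t) * w <= INR q * X / 4).
    { destruct q as [|q]; [simpl (INR 0); rewrite !Rmult_0_l, Rabs_R0; lra|].
      cbn [pred]. specialize (IH q (S j)). rewrite Rabs_mult, Rabs_pos_eq by lra.
      replace (INR (S q) * Rabs (kapjet s n q t) * w) with (Rabs (kapjet s n q t)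
        * (H ^ (q + S j) * fct (2 * (q + S j) + 1) / fct q)).
      - eapply Rle_trans; [exact IH|]. unfold X, F. rewrite S_INR.
        replace (2 * (n + S j) + 1)%nat with (2 * (S n + j) + 1)%nat by lia.
        fold F b. rewrite S_INR in hq. right. simpl pow.
        replace (4 * H) with (theta * b / 8) by (rewrite hth; unfold b; field; lra).
        field. lra.
      - unfold w. replace (S q + j)%nat with (q + S j)%nat by lia.
        rewrite fct_S, (S_INR q). field. pose proof (fct_pos q). pose proof (pos_INR q). lra. }
    (* the flat terms, where the two factorials fit into one *)
    assert (hB : Rabs (s ^ q / fct q * (INR q * flatjet s n 1 t + s * flatjet s n 2 t)) * w
      <= (INR q + 1) * X).
    { rewrite Rabs_mult, (Rabs_pos_eq (s ^ q / fct q))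
        by (apply Rdiv_le_0_compat; [apply pow_le; lra|apply fct_pos]).
      pose proof (flatjet_bound s n 1 t hs) as f1. pose proof (flatjet_bound s n 2 t hs) as f2.
      fold b in f1, f2.
      assert (hsum : Rabs (INR q * flatjet s n 1 t + s * flatjet s n 2 t)
        <= (INR q + 1) * (b ^ S n / 2 * (fct (2 * n + 2) / fct n))).
      { eapply Rle_trans; [apply Rabs_triang|].
        rewrite !Rabs_mult, (Rabs_pos_eq s), (Rabs_pos_eq (INR q)) by lra.
        assert (f1' : Rabs (flatjet s n 1 t) <= b ^ S n / 2 * (fct (2 * n + 2) / fct n)).
        { eapply Rle_trans; [exact f1|].
          replace (b ^ S n / 2 * (fct (2 * n + 2) / fct n)) with
            (b ^ n * fct (2 * n + 2) / (fct n * s ^ 1))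
            by (unfold b; simpl; field; lra).
          apply Rmult_le_compat_r.
          - apply Rlt_le, Rinv_0_lt_compat. simpl. nra.
          - apply Rmult_le_compat_l; [lra|].
            apply le_INR, fact_le. lia. }
        assert (f2' : s * Rabs (flatjet s n 2 t) <= b ^ S n / 2 * (fct (2 * n + 2) / fct n)).
        { apply (Rmult_le_compat_l s _ _ (Rlt_le _ _ hs)) in f2.
          eapply Rle_trans; [exact f2|]. right. unfold b. simpl. field. lra. }
        apply (Rmult_le_compat_l _ _ _ hq) in f1'. lra. }
      set (Q := b ^ S n / 2 * (fct (2 * n + 2) / fct n)) in *.
      assert (hQ : 0 < Q).
      { unfold Q. apply Rmult_lt_0_compat.
        - pose proof (pow_lt b (S n) hb). lra.
        - apply Rdiv_lt_0_compat; apply fct_pos. }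
      pose proof (kap_weight s H q j hs hH) as hkw. fold w in hkw. rewrite <- hth in hkw.
      apply Rle_trans with ((s ^ q / fct q * w) * ((INR q + 1) * Q)).
      { replace (s ^ q / fct q * Rabs (INR q * flatjet s n 1 t + s * flatjet s n 2 t) * w)
          with ((s ^ q / fct q * w) * Rabs (INR q * flatjet s n 1 t + s * flatjet s n 2 t)) by ring.
        apply Rmult_le_compat_l; [|exact hsum].
        apply Rmult_le_pos; [|lra].
        apply Rdiv_le_0_compat; [apply pow_le; lra|apply fct_pos]. }
      eapply Rle_trans; [apply Rmult_le_compat_r; [apply Rmult_le_pos; lra|exact hkw]|].
      assert (hff : fct (2 * j + 1) * fct (2 * n + 2) <= F).
      { eapply Rle_trans; [apply fct_mul_le|]. right. unfold F. f_equal. f_equal. lia. }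
      set (Z := (INR q + 1) * (theta ^ q * (4 * H) ^ j * b ^ S n / fct n)).
      assert (hZ : 0 <= Z).
      { unfold Z. apply Rmult_le_pos; [lra|]. apply Rdiv_le_0_compat; [|exact hn].
        pose proof (pow_lt b (S n) hb). apply Rmult_le_pos; [apply Rmult_le_pos|]; lra. }
      apply (Rmult_le_compat_l _ _ _ hZ) in hff.
      replace ((INR q + 1) * X) with (Z * F) by (unfold Z, X; field; lra).
      eapply Rle_trans; [|exact hff]. right. unfold Z, Q. field. lra. }
    cbn [kapjet]. assert (hSn : 0 < INR (S n)) by (apply lt_0_INR; lia).
    unfold Rdiv at 1. rewrite Rabs_mult, (Rabs_pos_eq (/ _))
      by (apply Rlt_le, Rinv_0_lt_compat, hSn).
    replace (2 * (INR q + 1) * theta ^ q * (4 * H) ^ j * b ^ S n * (F / fct (S n)))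
      with (2 * (INR q + 1) * X * / INR (S n)).
    2:{ unfold X. rewrite fct_S, (S_INR n) in *. field. lra. }
    rewrite (Rmult_comm (Rabs _)), Rmult_assoc, (Rmult_comm _ (/ INR (S n))).
    apply Rmult_le_compat_l; [apply Rlt_le, Rinv_0_lt_compat, hSn|].
    eapply Rle_trans; [apply Rmult_le_compat_r; [lra|apply Rabs_triang]|].
    rewrite Rabs_Ropp, Rmult_plus_distr_r. nra.
Qed.

Lemma is_csum_single (a : nat -> C) n : (forall k, k <> n -> a k = RtoC 0) ->
  is_csum a (a n).
Proof.
  intros h.
  assert (hr : forall f : nat -> R, (forall k, k <> n -> f k = 0) -> is_series f (f n)).
  { intros f hf. unfold is_series.
    apply (filterlim_ext_loc (fun _ : nat => f n)); [|apply filterlim_const].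
    exists n. intros m hm. symmetry. induction hm as [|m hm IH].
    - destruct n as [|n']; [apply sum_O|]. rewrite sum_Sn.
      assert (hz : forall m, (m < S n')%nat -> sum_n f m = 0).
      { induction m as [|m IHm]; intros hm.
        - rewrite sum_O. apply hf. lia.
        - rewrite sum_Sn, IHm, hf by lia. apply Rplus_0_l. }
      rewrite hz by lia. apply Rplus_0_l.
    - rewrite sum_Sn, IH, (hf (S m)) by lia. apply Rplus_0_r. }
  split.
  - apply (hr (fun k => fst (a k))). intros k hk. rewrite h by exact hk. reflexivity.
  - apply (hr (fun k => snd (a k))). intros k hk. rewrite h by exact hk. reflexivity.
Qed.

Lemma ex_series_linear_geom theta : 0 < theta < 1 ->
  ex_series (fun q => 2 * (INR q + 1) * theta ^ q).
Proof.
  intros hth. set (e := sqrt theta).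
  assert (he0 : 0 < e) by (apply sqrt_lt_R0; lra).
  assert (hee : e * e = theta) by (apply sqrt_sqrt; lra).
  assert (he1 : e < 1) by nra.
  set (c := / e - 1).
  assert (hc : 0 < c).
  { unfold c. apply Rlt_Rminus. rewrite <- Rinv_1. apply Rinv_lt_contravar; lra. }
  apply (ex_series_dominated _ (fun q => (2 * (/ c + 1)) * e ^ q)).
  2:{ apply (ex_series_scal_l _ (fun q => e ^ q)), ex_series_geom. rewrite Rabs_pos_eq; lra. }
  intros q. pose proof (pos_INR q) as hq.
  rewrite Rabs_pos_eq by (apply Rmult_le_pos; [lra|apply pow_le; lra]).
  (* Bernoulli's inequality for (1 + c) ^ q = e ^ (- q) *)
  pose proof (poly q c hc) as hp.
  replace (1 + c) with (/ e) in hp by (unfold c; ring).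
  pose proof (pow_lt e q he0) as heq. rewrite pow_inv in hp.
  rewrite <- hee, Rpow_mult_distr.
  assert (h1 : (1 + INR q * c) * e ^ q <= 1).
  { apply (Rmult_le_compat_r (e ^ q)) in hp; [|lra]. rewrite Rinv_l in hp; lra. }
  assert (h2 : (INR q + 1) * e ^ q <= / c + 1).
  { apply Rmult_le_reg_l with c; [exact hc|].
    replace (c * (/ c + 1)) with (1 + c) by (field; lra).
    assert (e ^ q <= 1) by (rewrite <- (pow1 q); apply pow_incr; lra).
    nra. }
  nra.
Qed.

(** Summation of [delta q * kap s q]. The rate [H] of the data becomes [2 / s], which
    can be any number larger than [32 * H]. *)
Lemma borel s H T (delta : nat -> C) M : 0 < s -> 0 < H -> 16 * s * H < 1 -> 0 <= M ->
  (forall q, Cmod (delta q) <= M * (H ^ q * gw 1 q)) ->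
  exists F : nat -> R -> C, njet 0 T F /\ (forall n, F n 0 = delta n) /\
    forall n t, 0 <= t ->
      Cmod (F n t) <= 2 * Series (fun q => 2 * (INR q + 1) * (16 * s * H) ^ q) * M
                      * ((2 / s) ^ n * gw 1 n).
Proof.
  intros hs hH hth1 hM hdelta. set (theta := 16 * s * H) in *.
  assert (hth0 : 0 < theta) by (unfold theta; apply Rmult_lt_0_compat; lra).
  assert (hex := ex_series_linear_geom theta (conj hth0 hth1)).
  set (bb := fun n => M * ((2 / s) ^ n * gw 1 n)).
  assert (hbb : forall n, 0 <= bb n).
  { intros n. apply Rmult_le_pos; [exact hM|].
    apply Rmult_le_pos; [apply pow_le, Rlt_le, Rdiv_lt_0_compat; lra|apply Rlt_le, gw_pos]. }
  assert (hterm : forall q n t, 0 <= t ->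
    Cmod (delta q * RtoC (kapjet s n q t)) <= bb n * (2 * (INR q + 1) * theta ^ q)).
  { intros q n t ht. rewrite Cmod_mult, Cmod_R.
    pose proof (kapjet_bound s H theta n q 0 t hs hH eq_refl ht) as hk.
    rewrite !Nat.add_0_r in hk.
    assert (hg : forall m, gw 1 m = fct (2 * m + 1) / fct m).
    { intros m. unfold gw. rewrite (Nat.add_comm 1). simpl (fct 1). f_equal. ring. }
    specialize (hdelta q). rewrite hg in hdelta.
    eapply Rle_trans; [apply Rmult_le_compat_r; [apply Rabs_pos|exact hdelta]|].
    apply (Rmult_le_compat_l M _ _ hM) in hk. unfold bb. rewrite hg. simpl pow in hk.
    unfold Rdiv in *. lra. }
  exists (fun n t => Csum (fun q => delta q * RtoC (kapjet s n q t))%C).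
  assert (hexb : forall n, ex_series (fun q => bb n * (2 * (INR q + 1) * theta ^ q)))
    by (intros n; exact (ex_series_scal_l (bb n) _ hex)).
  split; [|split].
  - apply (njet_Csum 0 T (fun q n t => delta q * RtoC (kapjet s n q t))%C
      (fun q n => bb n * (2 * (INR q + 1) * theta ^ q))).
    + intros q. exact (njet_scal 0 T (delta q) _ (kapjet_njet s q T hs)).
    + intros q n t [ht _]. apply hterm, ht.
    + exact hexb.
  - intros n. apply is_csum_unique.
    replace (delta n) with (delta n * RtoC (kapjet s n n 0))%C.
    + apply (is_csum_single (fun q => delta q * RtoC (kapjet s n q 0))%C).
      intros k hk. rewrite kapjet_0. destruct (Nat.eqb_spec k n); [contradiction|ring].
    + rewrite kapjet_0, Nat.eqb_refl. ring.
  - intros n t ht.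
    eapply Rle_trans; [apply (Csum_bound _ _ (fun q => hterm q n t ht) (hexb n))|].
    rewrite Series_scal_l. unfold bb. right. ring.
Qed.

(** * Gevrey interpolation of the jets at both ends of the time interval *)

Lemma flat0_continuous s t : 0 < s -> continuous (flat s 0) t.
Proof.
  intros hs. destruct (Rtotal_order t 0) as [h|[->|h]].
  - apply (continuous_ext_loc _ (fun _ => 0)); [|apply continuous_const].
    assert (hp : 0 < - t) by lra.
    exists (mkposreal _ hp). intros y hy. change (Rabs (y - t) < - t) in hy.
    apply Rabs_def2 in hy. rewrite flat_0; lra.
  - intros P [eps hP]. rewrite flat_0 in hP by lra.
    assert (hd : 0 < eps * s) by (apply Rmult_lt_0_compat; [apply cond_pos|exact hs]).
    exists (mkposreal _ hd). intros y hy. change (Rabs (y - 0) < eps * s) in hy.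
    apply hP. change (Rabs (flat s 0 y - 0) < eps). rewrite Rminus_0_r in *.
    rewrite <- flat_mult, Rabs_mult, (Rabs_pos_eq (flat s 1 y)) by apply flat_ge0.
    pose proof (flat_le s 1 y hs) as h1. simpl in h1.
    apply Rle_lt_trans with (Rabs y * (1 / (s * 1))).
    + apply Rmult_le_compat_l; [apply Rabs_pos|exact h1].
    + apply Rmult_lt_reg_r with s; [exact hs|].
      replace (Rabs y * (1 / (s * 1)) * s) with (Rabs y) by (field; lra). exact hy.
  - apply (ex_derive_continuous (V := R_NormedModule)).
    exists (flat' s 0 t). apply flat_derive, h.
Qed.

Lemma RInt_qder (h : R -> R) g T : (forall t, continuous h t) ->
  qder 0 T (fun t => RtoC (h t)) g ->
  qder 0 T (fun t => RtoC (RInt h 0 t)) (fun t => RtoC (h t)).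
Proof.
  intros hc hg. destruct (qder_Lipschitz _ _ _ _ hg) as [L [hL hl]].
  exists L. intros x y hx hy.
  rewrite <- RtoC_minus, <- RtoC_mult, <- RtoC_minus, Cmod_R.
  assert (hder : forall t, is_derive (RInt h 0) t (h t)).
  { intros t. apply (is_derive_RInt h (RInt h 0) 0 t); [|apply hc].
    apply filter_forall. intros z. apply (RInt_correct (V := R_CompleteNormedModule)).
    apply (ex_RInt_continuous (V := R_CompleteNormedModule)). intros; apply hc. }
  destruct (MVT_gen (RInt h 0) x y h) as [c [hcxy e]].
  - intros z _. apply hder.
  - intros z _. apply continuity_pt_filterlim.
    apply (ex_derive_continuous (V := R_NormedModule)). exists (h z). apply hder.
  - rewrite e. replace (h c * (y - x) - (y - x) * h x) with ((h c - h x) * (y - x)) by ring.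
    rewrite Rabs_mult, <- (pow2_abs (y - x)).
    assert (hcin : in_segment 0 T c /\ Rabs (c - x) <= Rabs (y - x)).
    { unfold in_segment in *. unfold Rmin, Rmax in hcxy. destruct (Rle_dec x y).
      - rewrite !Rabs_pos_eq by lra. lra.
      - rewrite !Rabs_left1 by lra. lra. }
    destruct hcin as [hcin hcx].
    specialize (hl x c hx hcin). rewrite <- RtoC_minus, Cmod_R in hl.
    pose proof (Rabs_pos (y - x)).
    replace (L * Rabs (y - x) ^ 2) with (L * Rabs (y - x) * Rabs (y - x)) by ring.
    apply Rmult_le_compat_r; [lra|]. eapply Rle_trans; [exact hl|].
    apply Rmult_le_compat_l; lra.
Qed.

(** A transition function with the jet of [1] at [0] and of [0] at [T]: the
    normalised primitive of [exp (- s / t) * exp (- s / (T - t))], which is flat at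
    both ends. The length [T] enters the constant only, not the rate. *)
Lemma transition_function s T : 0 < s -> 0 < T ->
  exists (C0 : R) (X : nat -> R -> C), 0 <= C0 /\ njet 0 T X /\
    X O 0 = RtoC 1 /\ (forall n, X (S n) 0 = RtoC 0) /\ (forall n, X n T = RtoC 0) /\
    forall n t, in_segment 0 T t -> Cmod (X n t) <= C0 * ((2 / s) ^ n * gw 0 n).
Proof.
  intros hs hT.
  set (h := fun t => flat s 0 t * flat s 0 (T - t)).
  set (P := fun n t => RtoC (flatjet s n 0 t)).
  set (Q := fun n t => (RtoC ((-1) ^ n) * P n (T - t)%R)%C).
  set (G := fun n t => conv (fun p => P p t) (fun p => Q p t) n).
  assert (hP : njet 0 T P) by apply (flatjet_njet s 0 T hs).
  assert (hQ : njet 0 T Q) by (apply (njet_reflect T P hP)).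
  assert (hG : njet 0 T G) by (apply njet_conv; assumption).
  assert (hG0 : forall t, G O t = RtoC (h t)).
  { intros t. unfold G, conv, Q, P, h. simpl. rewrite <- !RtoC_mult. f_equal. ring. }
  assert (hcont : forall t, continuous h t).
  { intros t. apply (continuous_mult (flat s 0) (fun t => flat s 0 (T - t))).
    - apply flat0_continuous, hs.
    - apply (continuous_comp (fun t => T - t) (flat s 0)); [|apply flat0_continuous, hs].
      apply (continuous_minus (V := R_NormedModule)); [apply continuous_const|apply continuous_id]. }
  set (Z := RInt h 0 T).
  assert (hZ : 0 < Z).
  { apply RInt_gt_0; [exact hT| |intros; apply hcont].
    intros x hx. unfold h. rewrite !flat_pos_eq by lra. simpl.
    apply Rmult_lt_0_compat; apply Rdiv_lt_0_compat; try lra; apply exp_pos. }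
  set (X := fun n t => match n with
    | O => (RtoC 1 - RtoC (/ Z) * RtoC (RInt h 0 t))%C
    | S m => (- (RtoC (/ Z) * / RtoC (INR (S m)) * G m t))%C
    end).
  assert (hX : njet 0 T X).
  { intros [|n].
    - assert (hh : qder 0 T (fun t => RtoC (h t)) (fun t => RtoC (INR 1) * G 1%nat t)%C).
      { eapply qder_ext; [|intros; reflexivity|exact (hG O)]. intros t _. apply hG0. }
      eapply qder_ext; [| |exact (qder_minus _ _ _ _ _ _ (qder_const 0 T (RtoC 1))
        (qder_scal 0 T (RtoC (/ Z)) _ _ (RInt_qder h _ T hcont hh)))];
        intros t _; cbv beta; [reflexivity|].
      unfold X. rewrite hG0. simpl INR. field.
    - eapply qder_ext; [| |exact (qder_scal 0 T
        (- (RtoC (/ Z) * / RtoC (INR (S n))))%C _ _ (hG n))]; intros t _; cbv beta.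
      + unfold X. ring.
      + unfold X. field. split; apply RtoC_neq_0; apply not_0_INR; lia. }
  set (b := 2 / s) in *. assert (hb : 0 < b) by (apply Rdiv_lt_0_compat; lra).
  destruct (qder_bounded _ _ _ _ (hX O)) as [B [hB hbd]].
  assert (hc : 0 < 4 / (Z * b)).
  { apply Rdiv_lt_0_compat; [lra|apply Rmult_lt_0_compat; assumption]. }
  exists (B + 4 / (Z * b)), X. split; [lra|]. split; [exact hX|].
  split; [|split; [|split]].
  - unfold X. rewrite RInt_point. change (zero : R) with 0. ring.
  - intros n. unfold X, G. assert (e : conv (fun p => P p 0) (fun p => Q p 0) n = RtoC 0).
    { apply csum_0. intros i _. unfold P at 1. rewrite flatjet_0. ring. }
    rewrite e. ring.
  - intros [|n]; unfold X.
    + fold Z. rewrite <- RtoC_mult, Rinv_l by lra. ring.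
    + unfold G. assert (e : conv (fun p => P p T) (fun p => Q p T) n = RtoC 0).
      { apply csum_0. intros i _. unfold Q, P. rewrite Rminus_diag, (flatjet_0 s (n - i)). ring. }
      rewrite e. ring.
  - intros [|n] t ht.
    + rewrite gw_0r. simpl pow. specialize (hbd t ht). lra.
    + unfold X. rewrite Cmod_opp, !Cmod_mult, Cmod_inv, !Cmod_R.
      2:{ apply RtoC_neq_0, not_0_INR. lia. }
      assert (hn : 0 < INR (S n)) by (apply lt_0_INR; lia).
      rewrite (Rabs_pos_eq (/ Z)), (Rabs_pos_eq (INR (S n)))
        by (apply Rlt_le; assumption || apply Rinv_0_lt_compat, hZ).
      assert (hPb : forall p u, Cmod (P p u) <= 1 * (b ^ p * gw 0 p)).
      { intros p u. unfold P. rewrite Cmod_R, Rmult_1_l.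
        eapply Rle_trans; [apply flatjet_bound, hs|]. fold b. unfold gw.
        rewrite Nat.add_0_l, Nat.add_0_r. simpl pow. simpl (fct 0). right. field.
        apply INR_fact_neq_0. }
      assert (hGb : Cmod (G n t) <= 4 * 1 * 1 * (b ^ n * gw (0 + 0) n)).
      { apply conv_bound; try lra; [intros; apply hPb|].
        intros p _. unfold Q. rewrite Cmod_mult, Cmod_R, pow_1_abs, Rmult_1_l. apply hPb. }
      simpl (0 + 0)%nat in hGb.
      assert (hgw : gw 0 n * / INR (S n) <= gw 0 (S n)).
      { unfold gw. rewrite !Nat.add_0_l, (fct_S n), <- S_INR. simpl (fct 0).
        pose proof (fct_pos n). pose proof (fct_pos (2 * n)).
        replace (fct (2 * n) / (1 * fct n) * / INR (S n)) with
          (fct (2 * n) / (1 * (INR (S n) * fct n))) by (field; lra).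
        apply Rmult_le_compat_r.
        - apply Rlt_le, Rinv_0_lt_compat. nra.
        - apply le_INR, fact_le. lia. }
      pose proof (pow_lt b n hb) as hbn. pose proof (gw_pos 0 (S n)) as hgn.
      apply Rle_trans with (4 / (Z * b) * (b ^ S n * gw 0 (S n))).
      * replace (4 / (Z * b) * (b ^ S n * gw 0 (S n))) with
          (/ Z * (4 * (b ^ n * gw 0 (S n)))) by (simpl pow; field; lra).
        rewrite Rmult_assoc. apply Rmult_le_compat_l; [apply Rlt_le, Rinv_0_lt_compat, hZ|].
        apply Rle_trans with (/ INR (S n) * (4 * 1 * 1 * (b ^ n * gw 0 n))).
        -- apply Rmult_le_compat_l; [apply Rlt_le, Rinv_0_lt_compat, hn|exact hGb].
        -- apply (Rmult_le_compat_l _ _ _ (Rlt_le _ _ hbn)) in hgw. lra.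
      * apply Rmult_le_compat_r; [|lra]. apply Rmult_le_pos; [apply pow_le|]; lra.
Qed.

Lemma pow_m1_sqr n : (-1) ^ n * (-1) ^ n = 1.
Proof. rewrite <- Rpow_mult_distr. replace (-1 * -1) with 1 by ring. apply pow1. Qed.

(** Two applications of [borel], the second with time reversed, glued by the
    transition function. By [gw_conv] a product of Gevrey functions of equal rate
    keeps that rate, so that the cutoff costs a constant only. *)
Lemma gevrey_interpolation s H T : 0 < s -> 0 < H -> 16 * s * H < 1 -> 0 < T ->
  exists K, 0 <= K /\ forall M (d0 dT : nat -> C), 0 <= M ->
    (forall n, Cmod (d0 n) <= M * (H ^ n * gw 1 n)) ->
    (forall n, Cmod (dT n) <= M * (H ^ n * gw 1 n)) ->
    exists G : nat -> R -> C, njet 0 T G /\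
      (forall n, G n 0 = d0 n) /\ (forall n, G n T = dT n) /\
      forall n t, in_segment 0 T t -> Cmod (G n t) <= K * M * ((2 / s) ^ n * gw 1 n).
Proof.
  intros hs hH hth hT.
  destruct (transition_function s T hs hT) as [C0 [X [hC0 [hX [hX0 [hXS [hXT hXb]]]]]]].
  assert (hth0 : 0 < 16 * s * H) by (apply Rmult_lt_0_compat; lra).
  set (S0 := 2 * Series (fun q => 2 * (INR q + 1) * (16 * s * H) ^ q)).
  assert (hS0 : 0 <= S0).
  { unfold S0. apply Rmult_le_pos; [lra|].
    apply Series_pos; [|apply ex_series_linear_geom; lra].
    intros q. pose proof (pos_INR q). apply Rmult_le_pos; [lra|apply pow_le; lra]. }
  set (b := 2 / s). assert (hb : 0 < b) by (apply Rdiv_lt_0_compat; lra).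
  assert (hone : forall M d, 0 <= M -> (forall n, Cmod (d n) <= M * (H ^ n * gw 1 n)) ->
    exists F : nat -> R -> C, njet 0 T F /\ (forall n, F n 0 = d n) /\
      (forall n, F n T = RtoC 0) /\
      forall n t, in_segment 0 T t -> Cmod (F n t) <= 4 * S0 * C0 * M * (b ^ n * gw 1 n)).
  { intros M d hM hd.
    destruct (borel s H T d M hs hH hth hM hd) as [F [hF [hF0 hFb]]].
    exists (fun n t => conv (fun p => F p t) (fun p => X p t) n).
    split; [apply njet_conv; assumption|split; [|split]].
    - intros n. unfold conv. destruct n as [|n]; cbn [csum].
      + rewrite Nat.sub_diag, hF0, hX0. ring.
      + rewrite Nat.sub_diag, hF0, hX0, csum_0; [ring|].
        intros i hi. rewrite Nat.sub_succ_l, hXS by exact hi. ring.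
    - intros n. apply csum_0. intros i _. rewrite hXT. ring.
    - intros n t ht.
      replace (4 * S0 * C0 * M) with (4 * (S0 * M) * C0) by ring.
      apply (conv_bound (fun p => F p t) (fun p => X p t) (S0 * M) C0 b 1 0 n);
        try assumption.
      + apply Rmult_le_pos; assumption.
      + intros p _. apply hFb. apply ht.
      + intros p _. apply hXb, ht. }
  exists (2 * (4 * S0 * C0)). split.
  { apply Rmult_le_pos; [lra|]. apply Rmult_le_pos; [lra|exact hC0]. }
  intros M d0 dT hM hd0 hdT.
  destruct (hone M d0 hM hd0) as [F [hF [hF0 [hFT hFb]]]].
  destruct (hone M (fun n => RtoC ((-1) ^ n) * dT n)%C hM) as [F' [hF' [hF0' [hFT' hFb']]]].
  { intros n. rewrite Cmod_mult, Cmod_R, pow_1_abs, Rmult_1_l. apply hdT. }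
  exists (fun n t => (F n t + RtoC ((-1) ^ n) * F' n (T - t)%R)%C).
  split; [apply njet_plus; [exact hF|apply njet_reflect, hF']|split; [|split]].
  - intros n. rewrite Rminus_0_r, hF0, hFT'. ring.
  - intros n. rewrite Rminus_diag, hFT, hF0'.
    replace (RtoC 0 + RtoC ((-1) ^ n) * (RtoC ((-1) ^ n) * dT n))%C with
      ((RtoC ((-1) ^ n) * RtoC ((-1) ^ n)) * dT n)%C by ring.
    rewrite <- RtoC_mult, pow_m1_sqr. ring.
  - intros n t ht. eapply Rle_trans; [apply Cmod_triangle|].
    rewrite Cmod_mult, Cmod_R, pow_1_abs, Rmult_1_l.
    assert (ht' : in_segment 0 T (T - t)) by (unfold in_segment in *; lra).
    pose proof (hFb n t ht). pose proof (hFb' n (T - t) ht'). fold b. lra.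
Qed.

(** * Summing the double series *)

(** Normalised derivatives of [x ^ k], by Leibniz' rule for [x * x ^ k]. *)
Fixpoint mono (k p : nat) (x : R) : R :=
  match k with
  | O => match p with O => 1 | S _ => 0 end
  | S k' => x * mono k' p x + match p with O => 0 | S p' => mono k' p' x end
  end.

Lemma mono_0 k x : mono k 0 x = x ^ k.
Proof. induction k as [|k IH]; simpl; [reflexivity|]. rewrite IH. ring. Qed.

Lemma mono_1 k x : mono (S k) 1 x = INR (S k) * x ^ k.
Proof.
  induction k as [|k IH]; [simpl; ring|].
  change (mono (S (S k)) 1 x) with (x * mono (S k) 1 x + mono (S k) 0 x).
  rewrite IH, mono_0, (S_INR (S k)). simpl pow. ring.
Qed.

Lemma mono_2 k x : 2 * mono (S (S k)) 2 x = INR (S k) * INR (S (S k)) * x ^ k.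
Proof.
  induction k as [|k IH]; [simpl; ring|].
  change (mono (S (S (S k))) 2 x) with (x * mono (S (S k)) 2 x + mono (S (S k)) 1 x).
  rewrite Rmult_plus_distr_l, <- Rmult_assoc, (Rmult_comm 2 x), Rmult_assoc, IH, mono_1.
  rewrite (S_INR (S (S k))), (S_INR (S k)). simpl pow. ring.
Qed.

Lemma mono_njet a b k : njet a b (fun p x => RtoC (mono k p x)).
Proof.
  induction k as [|k IH].
  - intros p. eapply qder_ext; [| |exact (qder_const a b (RtoC (mono 0 p 0)))];
      intros x _; cbv beta; [reflexivity|].
    change (mono 0 (S p) x) with 0. ring.
  - intros p. pose proof (qder_mult a b _ _ _ _ (qder_id a b) (IH p)) as h1.
    destruct p as [|p].
    + eapply qder_ext; [| |exact h1]; intros x _; cbv beta;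
        rewrite <- ?RtoC_mult, <- ?RtoC_plus, <- ?RtoC_mult; f_equal; simpl mono.
      * ring.
      * simpl INR. ring.
    + eapply qder_ext; [| |exact (qder_plus _ _ _ _ _ _ h1 (IH p))]; intros x _; cbv beta;
        rewrite <- ?RtoC_mult, <- ?RtoC_plus, <- ?RtoC_mult; f_equal.
      change (mono (S k) (S (S p)) x) with (x * mono k (S (S p)) x + mono k (S p) x).
      rewrite (S_INR (S p)). ring.
Qed.

Lemma mono_bound c k p x : 1 <= c -> 0 <= x <= 1 ->
  0 <= mono k p x <= c ^ p * (1 + / c) ^ k.
Proof.
  intros hc hx. assert (hci : 0 < / c) by (apply Rinv_0_lt_compat; lra).
  revert p. induction k as [|k IH]; intros p.
  - simpl pow at 2. rewrite Rmult_1_r. destruct p as [|p]; simpl; [lra|].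
    split; [lra|]. apply Rmult_le_pos; [lra|apply pow_le; lra].
  - destruct (IH p) as [h1 h2].
    pose proof (pow_le c p ltac:(lra)) as hcp.
    pose proof (pow_le (1 + / c) k ltac:(lra)) as hck.
    assert (hx1 : x * mono k p x <= c ^ p * (1 + / c) ^ k) by nra.
    destruct p as [|p].
    + simpl in *. split; [nra|]. nra.
    + change (mono (S k) (S p) x) with (x * mono k (S p) x + mono k p x).
      destruct (IH p) as [h3 h4]. split; [nra|].
      replace (c ^ S p * (1 + / c) ^ S k) with
        (c ^ S p * (1 + / c) ^ k + c ^ p * (1 + / c) ^ k) by (simpl pow; field; lra).
      lra.
Qed.

Lemma gw_le k q : gw k q <= (100 / 99) ^ k * 40000 ^ q * fct q.
Proof.
  pose proof (fct_split_le q q) as h1. replace (q + q)%nat with (2 * q)%nat in h1 by lia.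
  rewrite pow_mult in h1. replace (2 ^ 2) with 4 in h1 by ring.
  pose proof (bin_weight (99 / 100) (1 / 100) k (2 * q)
    ltac:(lra) ltac:(lra) ltac:(lra)) as h2.
  pose proof (fct_pos q) as hq. pose proof (fct_pos k) as hk.
  pose proof (bin_pos k (2 * q)) as hb.
  assert (e : gw k q = bin k (2 * q) * (fct (2 * q) / fct q)).
  { unfold gw, bin. pose proof (fct_pos (2 * q)). field. repeat split; lra. }
  rewrite e.
  assert (h3 : fct (2 * q) / fct q <= 4 ^ q * fct q).
  { apply Rle_div_l; [exact hq|]. lra. }
  assert (h4 : bin k (2 * q) <= (100 / 99) ^ k * 10000 ^ q).
  { rewrite pow_mult in h2. replace ((1 / 100) ^ 2) with (/ 10000) in h2 by field.
    replace (99 / 100) with (/ (100 / 99)) in h2 by field. rewrite !pow_inv in h2.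
    assert (0 < (100 / 99) ^ k) by (apply pow_lt; lra).
    assert (0 < 10000 ^ q) by (apply pow_lt; lra).
    apply Rmult_le_reg_r with (/ (100 / 99) ^ k * / 10000 ^ q).
    - apply Rmult_lt_0_compat; apply Rinv_0_lt_compat; assumption.
    - replace ((100 / 99) ^ k * 10000 ^ q * (/ (100 / 99) ^ k * / 10000 ^ q)) with 1
        by (field; lra). lra. }
  replace 40000 with (10000 * 4) by ring. rewrite Rpow_mult_distr.
  replace ((100 / 99) ^ k * (10000 ^ q * 4 ^ q) * fct q) with
    ((100 / 99) ^ k * 10000 ^ q * (4 ^ q * fct q)) by ring.
  apply Rmult_le_compat; try lra.
  apply Rdiv_le_0_compat; [apply Rlt_le, fct_pos|exact hq].
Qed.

Definition series_solution (U : nat -> nat -> R -> C) (p q : nat) (x t : R) : C :=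
  Csum (fun k => RtoC (mono k p x) * U k q t)%C.

(** The decay [(19 / 20) ^ k] leaves room for the binomial factors that [mono] and
    [gw] contribute, paid for by large powers in the orders [p] and [q]. *)
Lemma series_term_le (U : nat -> nat -> R -> C) M k p q x t :
  0 <= M -> 0 <= x <= 1 ->
  Cmod (U k q t) <= M * ((19 / 20) ^ k * (4 / 5) ^ q * gw k q) ->
  Cmod (RtoC (mono k p x) * U k q t)
    <= (M * 100 ^ p * 32000 ^ q * fct q) * (1919 / 1980) ^ k.
Proof.
  intros hM hx hU. rewrite Cmod_mult, Cmod_R.
  destruct (mono_bound 100 k p x ltac:(lra) hx) as [h1 h2].
  rewrite Rabs_pos_eq by exact h1.
  pose proof (gw_le k q) as h3.
  assert (hc : 0 <= (19 / 20) ^ k * (4 / 5) ^ q)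
    by (apply Rmult_le_pos; apply pow_le; lra).
  apply (Rmult_le_compat_l _ _ _ hc) in h3. apply (Rmult_le_compat_l _ _ _ hM) in h3.
  replace ((M * 100 ^ p * 32000 ^ q * fct q) * (1919 / 1980) ^ k) with
    ((100 ^ p * (1 + / 100) ^ k) * (M * ((19 / 20) ^ k * (4 / 5) ^ q
      * ((100 / 99) ^ k * 40000 ^ q * fct q)))).
  - apply Rmult_le_compat; [exact h1|apply Cmod_ge_0|exact h2|lra].
  - replace 32000 with (4 / 5 * 40000) by field.
    replace (1919 / 1980) with ((1 + / 100) * (19 / 20) * (100 / 99)) by field.
    rewrite !Rpow_mult_distr. ring.
Qed.

Lemma njet_ext a b F G : (forall n t, F n t = G n t) -> njet a b F -> njet a b G.
Proof.
  intros h hF n. eapply qder_ext; [| |exact (hF n)]; intros t _; cbv beta; rewrite h; reflexivity.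
Qed.

Lemma is_csum_shift2 a l : a O = RtoC 0 -> a 1%nat = RtoC 0 -> is_csum a l ->
  is_csum (fun k => a (S (S k))) l.
Proof.
  intros h0 h1 [hr hi].
  assert (hs : forall (f : nat -> R) m, f O = 0 -> f 1%nat = 0 -> is_series f m ->
    is_series (fun k => f (S (S k))) m).
  { intros f m e0 e1 h.
    apply (is_series_incr_1 (fun k => f (S k))). rewrite e1.
    replace (plus m 0) with m by (symmetry; apply Rplus_0_r).
    apply (is_series_incr_1 f). rewrite e0.
    replace (plus m 0) with m by (symmetry; apply Rplus_0_r). exact h. }
  split; [apply (hs (fun k => fst (a k)))|apply (hs (fun k => snd (a k)))];
    rewrite ?h0, ?h1; try reflexivity; assumption.
Qed.

Lemma conv_powers (u v : nat -> nat -> C) x k :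
  conv (fun i => RtoC (x ^ i) * u i O)%C (fun i => RtoC (x ^ i) * v i O)%C k
  = (RtoC (x ^ k) * conv2 u v k 0)%C.
Proof.
  unfold conv2, conv. cbn [csum]. rewrite <- csum_scal. apply csum_ext. intros i hi.
  replace (x ^ k) with (x ^ i * x ^ (k - i)).
  - rewrite RtoC_mult. cbn [Nat.sub]. ring.
  - rewrite <- pow_add. f_equal. lia.
Qed.

Section convergence.
Context (T M : R) (U : nat -> nat -> R -> C) (hM : 0 <= M)
  (hU : forall k, njet 0 T (U k))
  (hUb : forall k q t, in_segment 0 T t ->
    Cmod (U k q t) <= M * ((19 / 20) ^ k * (4 / 5) ^ q * gw k q)).

Lemma ex_series_terms c : ex_series (fun k => c * (1919 / 1980) ^ k).
Proof.
  apply (ex_series_scal_l c (fun k => (1919 / 1980) ^ k)), ex_series_geom.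
  rewrite Rabs_pos_eq; lra.
Qed.

Lemma series_solution_summable p q x t : in_segment 0 1 x -> in_segment 0 T t ->
  csummable (fun k => RtoC (mono k p x) * U k q t)%C.
Proof.
  intros hx ht. eapply csummable_le; [|apply ex_series_terms].
  intros k. exact (series_term_le U M k p q x t hM hx (hUb k q t ht)).
Qed.

Lemma series_solution_bound p q x t : in_segment 0 1 x -> in_segment 0 T t ->
  Cmod (series_solution U p q x t)
    <= (100 * M + 1) * fct q / ((/ 100) ^ p * (/ 32000) ^ q).
Proof.
  intros hx ht. eapply Rle_trans.
  { apply Csum_bound; [|apply ex_series_terms].
    intros k. exact (series_term_le U M k p q x t hM hx (hUb k q t ht)). }
  rewrite Series_scal_l, Series_geom by (rewrite Rabs_pos_eq; lra).
  replace (/ (1 - 1919 / 1980)) with (1980 / 61) by field.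
  rewrite !pow_inv. unfold Rdiv at 2. rewrite <- Rinv_mult, !Rinv_inv.
  pose proof (pow_lt 100 p ltac:(lra)). pose proof (pow_lt 32000 q ltac:(lra)).
  pose proof (fct_pos q).
  set (A := 100 ^ p * 32000 ^ q) in *. assert (hA : 0 < A) by (unfold A; nra).
  replace (2 * (M * 100 ^ p * 32000 ^ q * fct q * (1980 / 61))) with
    (3960 / 61 * M * (fct q * A)) by (unfold A; field).
  rewrite (Rmult_assoc (100 * M + 1)). apply Rmult_le_compat_r; [|lra].
  apply Rlt_le, Rmult_lt_0_compat; assumption.
Qed.

Lemma series_solution_bijet : bijet 0 1 0 T (series_solution U).
Proof.
  split.
  - intros q t ht.
    apply (njet_Csum 0 1 (fun k p x => RtoC (mono k p x) * U k q t)%C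
      (fun k p => (M * 100 ^ p * 32000 ^ q * fct q) * (1919 / 1980) ^ k)).
    + intros k. apply (njet_ext 0 1 (fun p x => U k q t * RtoC (mono k p x))%C).
      * intros p x. ring.
      * apply njet_scal, mono_njet.
    + intros k p x hx. exact (series_term_le U M k p q x t hM hx (hUb k q t ht)).
    + intros p. apply ex_series_terms.
  - intros p x hx.
    apply (njet_Csum 0 T (fun k q t => RtoC (mono k p x) * U k q t)%C
      (fun k q => (M * 100 ^ p * 32000 ^ q * fct q) * (1919 / 1980) ^ k)).
    + intros k. apply njet_scal, hU.
    + intros k q t ht. exact (series_term_le U M k p q x t hM hx (hUb k q t ht)).
    + intros q. apply ex_series_terms.
  - intros p q. exists ((100 * M + 1) * fct q / ((/ 100) ^ p * (/ 32000) ^ q)).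
    split; [|intros x t; apply series_solution_bound].
    pose proof (fct_pos q). apply Rdiv_le_0_compat; [nra|].
    apply Rmult_lt_0_compat; apply pow_lt; lra.
Qed.

Lemma series_solution_pde th ph x t : (forall t, solves th ph (fun k n => U k n t)) ->
  in_segment 0 1 x -> in_segment 0 T t ->
  (series_solution U 0 1 x t
   = cis th * (RtoC 2 * series_solution U 2 0 x t)
     + cis ph * (series_solution U 0 0 x t * series_solution U 0 0 x t
                 * Cconj (series_solution U 0 0 x t)))%C.
Proof.
  intros hs hx ht.
  pose proof (series_solution_summable 0 0 x t hx ht) as s0.
  pose proof (series_solution_summable 2 0 x t hx ht) as s2.
  set (u := fun k n => U k n t). set (y := series_solution U 0 0 x t).
  set (c := fun k => (RtoC (x ^ k) * u k O)%C).
  set (cc := fun k => (RtoC (x ^ k) * Cconj (u k O))%C).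
  assert (hcy : is_csum c y).
  { eapply is_csum_ext; [|exact (Csum_correct _ s0)]. intros k. unfold c.
    rewrite mono_0. reflexivity. }
  assert (hcs : csummable c).
  { eapply ex_series_ext; [|exact s0]. intros k. unfold c. rewrite mono_0. reflexivity. }
  assert (hcc : forall k, Cconj (c k) = cc k).
  { intros k. unfold c, cc. rewrite Cmult_conj. f_equal.
    unfold Cconj, RtoC. simpl. f_equal. ring. }
  assert (hccy : is_csum cc (Cconj y)).
  { eapply is_csum_ext; [exact hcc|]. apply is_csum_conj, hcy. }
  assert (hccs : csummable cc).
  { eapply ex_series_ext; [|exact hcs]. intros k. rewrite <- hcc, Cmod_conj. reflexivity. }
  assert (hcub : is_csum (fun k => RtoC (x ^ k) * cubic u k 0)%C (y * y * Cconj y)%C).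
  { pose proof (is_csum_conv _ _ _ _ (is_csum_conv _ _ _ _ hcy hcy hcs hcs) hccy
      (csummable_conv _ _ hcs hcs) hccs) as h.
    eapply is_csum_ext; [|exact h]. intros k. cbv beta. unfold cubic.
    rewrite <- (conv_powers (conv2 u u) (fun k n => Cconj (u k n))).
    apply conv_ext; [|reflexivity]. intros i _. apply (conv_powers u u). }
  assert (h2 : is_csum (fun k => RtoC (mono (S (S k)) 2 x) * u (S (S k)) O)%C
    (series_solution U 2 0 x t)).
  { apply (is_csum_shift2 (fun k => RtoC (mono k 2 x) * u k O)%C).
    - simpl mono. ring.
    - simpl mono. rewrite Rmult_0_r, Rplus_0_r. ring.
    - exact (Csum_correct _ s2). }
  apply is_csum_unique.
  eapply is_csum_ext; [|exact (is_csum_plus _ _ _ _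
    (is_csum_scal (cis th) _ _ (is_csum_scal (RtoC 2) _ _ h2))
    (is_csum_scal (cis ph) _ _ hcub))].
  intros k. cbv beta. rewrite mono_0.
  pose proof (hs t k O) as e. fold u in e. cbv beta in e. simpl INR in e at 1.
  replace (U k 1%nat t) with (RtoC 1 * u k 1%nat)%C by (unfold u; ring). rewrite e.
  replace (cis th * (RtoC 2 * (RtoC (mono (S (S k)) 2 x) * u (S (S k)) 0%nat)))%C with
    (cis th * (RtoC (2 * mono (S (S k)) 2 x) * u (S (S k)) 0%nat))%C
    by (rewrite RtoC_mult; ring).
  rewrite mono_2, (RtoC_mult (INR (S k) * INR (S (S k)))).
  change (fun k n => u k n) with u. unfold u. ring.
Qed.

End convergence.

(** * Odd analytic data *)

Lemma is_pseries_csum (a : nat -> C) x l :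
  is_pseries (K := R_AbsRing) (V := C_R_NormedModule) a x l ->
  is_csum (fun k => RtoC (x ^ k) * a k)%C l.
Proof.
  intros h. unfold is_pseries in h.
  assert (h' : is_series (K := R_AbsRing) (V := C_R_NormedModule)
    (fun k => RtoC (x ^ k) * a k)%C l).
  { eapply is_series_ext; [|exact h]. intros k. simpl. rewrite pow_n_pow.
    destruct (a k). unfold scal. simpl. unfold prod_scal, scal. simpl. unfold mult.
    simpl. unfold Cmult, RtoC. simpl. f_equal; ring. }
  assert (hf : forall (f : nat -> C) m, fst (sum_n (G := C_R_NormedModule) f m)
    = sum_n (fun k => fst (f k)) m).
  { intros f m. induction m as [|m IH]; [rewrite !sum_O; reflexivity|].
    rewrite !sum_Sn, <- IH. reflexivity. }
  assert (hsd : forall (f : nat -> C) m, snd (sum_n (G := C_R_NormedModule) f m)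
    = sum_n (fun k => snd (f k)) m).
  { intros f m. induction m as [|m IH]; [rewrite !sum_O; reflexivity|].
    rewrite !sum_Sn, <- IH. reflexivity. }
  split; unfold is_series.
  - eapply filterlim_ext; [intros m; apply hf|]. eapply filterlim_comp; [exact h'|].
    intros P [eps hP]. exists eps. intros z [hz _]. apply hP, hz.
  - eapply filterlim_ext; [intros m; apply hsd|]. eapply filterlim_comp; [exact h'|].
    intros P [eps hP]. exists eps. intros z [_ hz]. apply hP, hz.
Qed.

(** Instead of showing that the even coefficients vanish, average the expansions of
    [z x] and [- z (- x)]: this removes them and keeps the bounds. *)
Lemma odd_analytic_coefficients r K z : 0 < r -> analytic_class r K z -> odd_function z ->
  exists eps : nat -> C,
    (forall k, Nat.odd k = false -> eps k = RtoC 0) /\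
    (forall k, Cmod (eps k) <= K / r ^ k) /\
    (forall x, in_segment 0 1 x -> is_csum (fun k => RtoC (x ^ k) * eps k)%C (z x)).
Proof.
  intros hr [alpha [halpha hz]] hodd.
  assert (hb : forall k, Cmod (alpha k / RtoC (fct k)) <= K / r ^ k).
  { intros k. pose proof (fct_pos k) as hk. pose proof (pow_lt r k hr) as hrk.
    rewrite Cmod_div by (apply RtoC_neq_0; lra).
    rewrite Cmod_R, Rabs_pos_eq by lra.
    apply Rle_div_l; [exact hk|]. eapply Rle_trans; [apply halpha|].
    right. field. lra. }
  exists (fun k => if Nat.odd k then (alpha k / RtoC (fct k))%C else RtoC 0).
  split; [|split].
  - intros k ->. reflexivity.
  - intros k. destruct (Nat.odd k); [apply hb|]. rewrite Cmod_0.
    eapply Rle_trans; [apply Cmod_ge_0|apply (hb k)].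
  - intros x hx. unfold in_segment in *.
    pose proof (is_pseries_csum _ _ _ (hz x ltac:(unfold in_segment; lra))) as h1.
    pose proof (is_pseries_csum _ _ _ (hz (- x) ltac:(unfold in_segment; lra))) as h2.
    rewrite hodd in h2 by (unfold in_segment; lra).
    pose proof (is_csum_plus _ _ _ _ (is_csum_scal (RtoC (/ 2)) _ _ h1)
      (is_csum_scal (- RtoC (/ 2))%C _ _ h2)) as h3.
    replace (RtoC (/ 2) * z x + - RtoC (/ 2) * - z x)%C with (z x) in h3.
    2:{ replace (RtoC (/ 2) * z x + - RtoC (/ 2) * - z x)%C with
          (RtoC (/ 2 + / 2) * z x)%C by (rewrite RtoC_plus; ring).
        replace (/ 2 + / 2) with 1 by field. ring. }
    eapply is_csum_ext; [|exact h3]. intros k. cbv beta.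
    replace ((- x) ^ k) with (if Nat.odd k then - x ^ k else x ^ k).
    + destruct (Nat.odd k).
      * rewrite RtoC_opp.
        replace (RtoC (/ 2) * (RtoC (x ^ k) * (alpha k / RtoC (fct k))) +
          - RtoC (/ 2) * (- RtoC (x ^ k) * (alpha k / RtoC (fct k))))%C with
          (RtoC (/ 2 + / 2) * (RtoC (x ^ k) * (alpha k / RtoC (fct k))))%C
          by (rewrite RtoC_plus; ring).
        replace (/ 2 + / 2) with 1 by field. ring.
      * ring.
    + clear. induction k as [|k IH]; [reflexivity|].
      rewrite Nat.odd_succ, <- Nat.negb_odd. simpl pow. rewrite <- IH.
      destruct (Nat.odd k); simpl; ring.
Qed.

(** * Steering one small odd state to another *)

Lemma R_hat_ge_8 : 8 <= R_hat.
Proof.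
  unfold R_hat. pose proof (exp_pos 1) as h1.
  assert (h2 : 0 < / (2 * exp 1)) by (apply Rinv_0_lt_compat; lra).
  pose proof (exp_ineq1_le (/ (2 * exp 1))). lra.
Qed.

Theorem theorem2p5 (theta phi r T : R) (hr : R_hat < r) (hT : 0 < T) :
  exists K : R, 0 < K /\
    forall y0 yT : R -> C,
      analytic_class r K y0 -> odd_function y0 ->
      analytic_class r K yT -> odd_function yT ->
      exists (y : R -> R -> C) (v : R -> C),
        gevrey2 1 2 0 1 0 T y /\
        gevrey 2 0 T v /\
        (forall x t : R, in_segment 0 1 x -> in_segment 0 T t ->
           partial_t 0 T y x t =
             (cis theta * partial_x 0 1 (partial_x 0 1 y) x t
              + cis phi * RtoC (Cmod (y x t) ^ 2) * y x t)%C) /\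
        (forall t : R, in_segment 0 T t ->
           y 0 t = RtoC 0 /\ y 1 t = v t) /\
        (forall x : R, in_segment 0 1 x -> y x 0 = y0 x) /\
        (forall x : R, in_segment 0 1 x -> y x T = yT x).
Proof.
  pose proof R_hat_ge_8 as hR.
  (* The jets of a state of radius above 8 grow at the rate H, slightly more than
     1 / 64 to make room for the cubic term. Interpolation needs 16 * s * H < 1 and
     yields the rate 2 / s = 4 / 5, below (19 / 20) ^ 2: marching in space then gives
     coefficients of decay rate 19 / 20, again with room for the cubic term. *)
  set (s := 5 / 2). set (H := 3 / 160).
  assert (hb : 2 / s = 4 / 5) by (unfold s; field).
  destruct (gevrey_interpolation s H T) as [Kg [hKg hinterp]];
    [unfold s; lra|unfold H; lra|unfold s, H; lra|exact hT|].
  (* M <= 1 / 72 serves the march in time, Kg * M <= 1 / 72 the march in space *)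
  set (M := / (72 * (Kg + 1))).
  assert (hM : 0 < M) by (apply Rinv_0_lt_compat; lra).
  assert (hMK : (Kg + 1) * M = / 72) by (unfold M; field; lra).
  assert (hM72 : M <= / 72) by nra.
  exists M. split; [exact hM|]. intros y0 yT ha0 ho0 haT hoT.
  (* all derivatives at a given instant, at the end point in particular, are forced
     by the state at that instant *)
  assert (hjets : forall z, analytic_class r M z -> odd_function z ->
    exists u, solves theta phi u /\ (forall n, u O n = RtoC 0) /\
      (forall n, Cmod (u 1%nat n) <= M * (H ^ n * gw 1 n)) /\
      forall x, in_segment 0 1 x -> is_csum (fun k => RtoC (x ^ k) * u k O)%C (z x)).
  { intros z hz hodd.
    destruct (odd_analytic_coefficients r M z ltac:(lra) hz hodd) as [e [he0 [heb hez]]].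
    destruct (solves_time_exists theta phi e) as [u [hu hu0]].
    exists u. split; [exact hu|split; [|split]].
    - intros n. apply (solves_odd theta phi u hu); [|reflexivity].
      intros k hk. rewrite hu0. apply he0, hk.
    - intros n.
      assert (hbd : Cmod (u 1%nat n) <= M * ((1 / 8) ^ 1 * H ^ n * gw 1 n)).
      { apply (solves_time_bound theta phi u M (1 / 8) H hu); try (unfold H; lra).
        - unfold H. nra.
        - intros k. rewrite hu0. eapply Rle_trans; [apply heb|].
          apply Rmult_le_compat_l; [lra|].
          replace (1 / 8) with (/ 8) by field. rewrite pow_inv.
          apply Rinv_le_contravar; [apply pow_lt; lra|apply pow_incr; lra]. }
      assert (0 < H ^ n * gw 1 n).
      { apply Rmult_lt_0_compat; [apply pow_lt; unfold H; lra|apply gw_pos]. }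
      nra.
    - intros x hx. eapply is_csum_ext; [|exact (hez x hx)].
      intros k. cbv beta. rewrite hu0. reflexivity. }
  destruct (hjets y0 ha0 ho0) as [u0 [hs0 [hz0 [hb0 hy0]]]].
  destruct (hjets yT haT hoT) as [uT [hsT [hzT [hbT hyT]]]].
  destruct (hinterp M (u0 1%nat) (uT 1%nat) ltac:(lra) hb0 hbT) as [G [hG [hG0 [hGT hGb]]]].
  rewrite hb in hGb.
  set (U := fun k n t => space_solution theta phi (fun m => G m t) k n).
  assert (hUs : forall t, solves theta phi (fun k n => U k n t))
    by (intros t; apply space_solution_eq).
  assert (hU0 : forall n t, U O n t = RtoC 0) by (intros n t; apply space_solution_eq).
  assert (hU1 : forall n t, U 1%nat n t = G n t).
  { intros n t. destruct (space_solution_eq theta phi (fun m => G m t)) as [_ [h _]]. apply h. }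
  assert (hU : forall k, njet 0 T (U k)).
  { apply (solves_njet theta phi 0 T U hUs).
    - apply (njet_ext 0 T (fun _ _ => RtoC 0)); [intros; symmetry; apply hU0|].
      intros n. eapply qder_ext; [| |exact (qder_const 0 T (RtoC 0))]; intros t _; cbv beta; ring.
    - apply (njet_ext 0 T G); [intros; symmetry; apply hU1|exact hG]. }
  assert (hM2 : 0 <= / 20) by lra.
  assert (hUb : forall k q t, in_segment 0 T t ->
    Cmod (U k q t) <= / 20 * ((19 / 20) ^ k * (4 / 5) ^ q * gw k q)).
  { intros k q t ht.
    apply (solves_space_bound theta phi (fun k n => U k n t) (/ 20) (19 / 20) (4 / 5) (hUs t));
      try lra.
    - intros n. apply hU0.
    - intros n. cbv beta. rewrite hU1. eapply Rle_trans; [apply hGb, ht|].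
      assert (0 < (4 / 5) ^ n * gw 1 n).
      { apply Rmult_lt_0_compat; [apply pow_lt; lra|apply gw_pos]. }
      assert (Kg * M <= / 72) by nra. nra. }
  set (Y := series_solution U).
  assert (hY : bijet 0 1 0 T Y) by exact (series_solution_bijet T (/ 20) U hM2 hU hUb).
  set (y := Y O O).
  assert (hrep : represents 0 1 0 T Y y 0 0).
  { intros x t _ _. unfold y. simpl (fct 0). rewrite Rmult_1_r. ring. }
  assert (h01 : 0 < 1) by lra.
  exists y, (fun t => y 1 t).
  split; [|split; [|split; [|split; [|split]]]].
  - apply (gevrey2_bijet 0 1 0 T h01 hT Y hY y (100 * / 20 + 1) (/ 100) (/ 32000) hrep);
      try lra.
    intros p q x t hx ht. exact (series_solution_bound T (/ 20) U hM2 hUb p q x t hx ht).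
  - assert (h1 : in_segment 0 1 1) by (unfold in_segment; lra).
    apply (gevrey_njet 0 T (fun q t => Y O q 1 t) _ (100 * / 20 + 1) (/ 32000) hT); try lra.
    + exact (bijet_t _ _ _ _ _ hY O 1 h1).
    + reflexivity.
    + intros q t ht.
      pose proof (series_solution_bound T (/ 20) U hM2 hUb 0 q 1 t h1 ht) as h.
      simpl pow in h at 1. rewrite Rmult_1_l in h. exact h.
  - intros x t hx ht.
    rewrite (represents_partial_t 0 1 0 T hT Y hY y 0 0 hrep x t hx ht).
    rewrite (represents_partial_x 0 1 0 T h01 Y hY _ 1 0
      (represents_partial_x 0 1 0 T h01 Y hY y 0 0 hrep) x t hx ht).
    rewrite Cmod2_conj.
    pose proof (series_solution_pde T (/ 20) U hM2 hUb theta phi x t hUs hx ht) as e.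
    fold Y in e. fold y in e. unfold Y at 1. simpl (fct 0 * fct 1). simpl (fct 2 * fct 0).
    fold Y. change (Y O O x t) with (y x t) in e.
    rewrite Rmult_1_r, e.
    replace ((1 + 1) * 1) with 2 by ring. ring.
  - intros t ht. split; [|reflexivity].
    unfold y, Y, series_solution. apply is_csum_unique.
    replace (RtoC 0) with (RtoC (mono 0 0 0) * U O O t)%C by (rewrite hU0; ring).
    apply (is_csum_single (fun k => RtoC (mono k 0 0) * U k O t)%C).
    intros [|k] hk; [lia|]. rewrite mono_0. simpl pow. rewrite Rmult_0_l. ring.
  - intros x hx. unfold y, Y, series_solution. apply is_csum_unique.
    eapply is_csum_ext; [|exact (hy0 x hx)]. intros k. cbv beta. rewrite mono_0. f_equal.
    apply (solves_unique theta phi u0 (fun k n => U k n 0) hs0 (hUs 0)).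
    + intros n. rewrite hz0, hU0. reflexivity.
    + intros n. rewrite hU1, hG0. reflexivity.
  - intros x hx. unfold y, Y, series_solution. apply is_csum_unique.
    eapply is_csum_ext; [|exact (hyT x hx)]. intros k. cbv beta. rewrite mono_0. f_equal.
    apply (solves_unique theta phi uT (fun k n => U k n T) hsT (hUs T)).
    + intros n. rewrite hzT, hU0. reflexivity.
    + intros n. rewrite hU1, hGT. reflexivity.
Qed.
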